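(* Let $V$ be a DVR with quotient field $K$ and perfect residue field. Let $\mathcal{K}$ be the family of all finite extensions of $\widehat K$ (inside $\overline{\widehat K}$). Then $$\mathbb{K}^{\mathrm{br}}=\bigcup_{F\in\mathcal{K}}\widehat{F^{\mathrm{ur}}}.$$
   Context: A DVR is a discrete valuation domain of rank one (value group isomorphic to $\mathbb{Z}$). $V$ is a DVR with quotient field $K$, associated valuation $v$ and value group $\Gamma_v$. $\widehat K$ is the $v$-adic completion of $K$, $\overline{\widehat K}$ an algebraic closure of $\widehat K$, and $v$ also denotes its unique extension to $\overline{\widehat K}$; $\mathbb{K}$ is the completion of $\overline{\widehat K}$ with respect to $v$, with the extended valuation again denoted $v$. For $s\in\mathbb{K}$, $e_s=e(\widehat K(s)\mid\widehat K)$ is the ramification index, i.e. the index of $v(\widehat K^\times)=\Gamma_v$ in $v(\widehat K(s)^\times)$, an element of $\mathbb{N}\cup\{\infty\}$; put $\mathbb{K}^{\mathrm{br}}=\{\alpha\in\mathbb{K}\mid e_\alpha<\infty\}$. For a finite extension $F$ of $\widehat K$ inside $\overline{\widehat K}$, $F^{\mathrm{ur}}$ is the maximal unramified extension of $F$ in $\overline{\widehat K}$ (the compositum of all finite unramified extensions of $F$ in $\overline{\widehat K}$, where unramified means ramification index $1$ and separable residue field extension), and $\widehat{F^{\mathrm{ur}}}$ is its completion, viewed as a subfield of $\mathbb{K}$ (the closure of $F^{\mathrm{ur}}$ in $\mathbb{K}$). *)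

(* Defs.v *)
From HB Require Import structures.
From mathcomp Require Import all_boot all_order all_algebra separable finmap.
From mathcomp Require Import generic_quotient.
From mathcomp Require Import boolp classical_sets functions cardinality.
From mathcomp Require Import reals constructive_ereal.
Import Order.TTheory GRing.Theory Num.Theory.

Set Implicit Arguments.
Unset Strict Implicit.
Unset Printing Implicit Defensive.

Local Open Scope classical_set_scope.
Local Open Scope ereal_scope.
Local Open Scope ring_scope.

(** A rank-one valuation, written additively with values in [R] and
    [v 0 = +oo]; the value group is only required to be a subgroup of [R], so
    that one type covers a discrete valuation and its extensions to algebraic
    extensions and completions. *)
Record valuation (R : realType) (L : fieldType) := Valuation {
  val_fun :> L -> \bar R;
  val_fin : forall x, x != 0 -> val_fun x \is a fin_num;
  val0 : val_fun 0 = +oo%E;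
  valM : forall x y, val_fun (x * y)%R = (val_fun x + val_fun y)%E;
  valD : forall x y, (Order.min (val_fun x) (val_fun y) <= val_fun (x + y)%R)%E
}.

Section ValuationTheory.
Context {R : realType} {L : fieldType} (v : valuation R L).

Lemma val1 : v 1 = 0%E.
Proof.
have h := valM v 1 1; rewrite mulr1 in h.
have := val_fin v (oner_neq0 L); case: (v 1) h => //= r [h] _.
by congr EFin; apply: (addrI r); rewrite -h addr0.
Qed.

Lemma valN x : v (- x) = v x.
Proof.
have hN1 : v (-1) = 0%E.
  have h := valM v (-1) (-1); rewrite mulrNN mulr1 val1 in h.
  have : v (-1) \is a fin_num by apply: val_fin; rewrite oppr_eq0 oner_neq0.
  case: (v (-1)) h => //= r [h] _; congr EFin; apply/eqP.
  by rewrite -[_ == _](mulrn_eq0 r 2) mulr2n -h.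
by rewrite -mulN1r valM hN1 add0e.
Qed.

Lemma valB x y : (Order.min (v x) (v y) <= v (x - y)%R)%E.
Proof. by rewrite -(valN y); exact: valD. Qed.

Lemma valV x : x != 0 -> v x = 0%E -> v x^-1 = 0%E.
Proof.
by move=> x0 vx; have := valM v x x^-1; rewrite divff// val1 vx add0e => <-.
Qed.

Definition in_valuation_ring : {pred L} := fun x => (0%E <= v x)%E.

Fact in_valuation_ring_closed : subring_closed in_valuation_ring.
Proof.
split=> [|x y|x y]; rewrite /in_mem /= /in_valuation_ring.
- by rewrite val1.
- by move=> hx hy; apply: le_trans (valB x y); rewrite le_min hx hy.
- by move=> hx hy; rewrite valM adde_ge0.
Qed.

HB.instance Definition _ :=
  GRing.isSubringClosed.Build L in_valuation_ring in_valuation_ring_closed.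

Definition valuation_ring : Type := {x : L | in_valuation_ring x}.

HB.instance Definition _ := SubType.on valuation_ring.
HB.instance Definition _ := Choice.on valuation_ring.
HB.instance Definition _ := [SubChoice_isSubComNzRing of valuation_ring by <:].

Definition maximal_ideal : {pred valuation_ring} :=
  fun x => (0%E < v (val x))%E.

Fact maximal_ideal_closed : idealr_closed maximal_ideal.
Proof.
split=> [||a x y]; rewrite /in_mem /= /maximal_ideal.
- by rewrite rmorph0 val0 ltry.
- by rewrite rmorph1 val1 ltxx.
move=> hx hy; rewrite rmorphD rmorphM /=.
apply: lt_le_trans (valD _ _ _); rewrite lt_min hy andbT valM.
by apply: lt_le_trans hx _; rewrite leeDr//; exact: (valP a).
Qed.

HB.instance Definition _ :=
  isIdealr.Build valuation_ring maximal_ideal maximal_ideal_closed.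

Definition residue_field : Type := {ideal_quot maximal_ideal}.

HB.instance Definition _ := GRing.ComNzRing.on residue_field.

Definition residue (x : valuation_ring) : residue_field :=
  \pi_{ideal_quot maximal_ideal}%qT x.

Lemma residue_eq0 x : (residue x == 0) = (0%E < v (val x))%E.
Proof.
have -> : (0%E < v (val x))%E = (x - 0 \in maximal_ideal) by rewrite subr0.
rewrite Quotient.idealrBE; congr (_ == _).
by rewrite -(@pi_zeror _ _ _ _ _ {ideal_quot maximal_ideal}).
Qed.

Lemma residueM : {morph residue : x y / x * y}.
Proof. exact: (@pi_mulr _ _ _ _ _ _ _ {ideal_quot maximal_ideal}). Qed.

Lemma residue1 : residue 1 = 1.
Proof. exact: (@pi_oner _ _ _ _ _ _ _ {ideal_quot maximal_ideal}). Qed.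

Lemma residueK (q : residue_field) : residue (repr q) = q.
Proof. exact: (@reprK _ {ideal_quot maximal_ideal}). Qed.

(** Inverses of non-units lie outside the valuation ring, and [insubd] then
    returns [0]. *)
Definition residue_inv (q : residue_field) : residue_field :=
  residue (insubd 0 (val (repr q : valuation_ring))^-1).

Fact residue_mulVf (q : residue_field) : q != 0 -> residue_inv q * q = 1.
Proof.
rewrite -{1 3}(residueK q) residue_eq0 /residue_inv.
set x : valuation_ring := repr q => vx.
have vx0 : v (val x) = 0%E.
  by apply/eqP; rewrite eq_le (valP x : (0%E <= _)%E) andbT leNgt.
have x0 : val x != 0 by apply/eqP => h; rewrite h val0 in vx0.
rewrite -residueM -residue1; congr residue; apply: val_inj.
rewrite rmorphM rmorph1 /= insubdK ?mulVf//.
by rewrite /in_mem /= /in_valuation_ring valV.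
Qed.

Fact residue_inv0 : residue_inv 0 = 0.
Proof.
apply/eqP; rewrite /residue_inv residue_eq0.
set x : valuation_ring := repr 0.
have vx : (0%E < v (val x))%E by rewrite -residue_eq0 residueK.
have [->|x0] := eqVneq (val x) 0; first by rewrite invr0 val_insubd if_same val0 ltry.
rewrite val_insubd ifF ?rmorph0 ?val0 ?ltry//; apply/negbTE; rewrite /in_valuation_ring -ltNge.
have := valM v (val x) (val x)^-1; rewrite divff// val1.
have := val_fin v x0; have := val_fin v (invr_neq0 x0).
case: (v _) vx => [r||]//; case: (v _^-1) => [s||]//.
rewrite !lte_fin => r0 _ _ [/esym/eqP]; rewrite addrC addr_eq0 => /eqP ->.
by rewrite oppr_lt0.
Qed.

HB.instance Definition _ :=
  GRing.ComNzRing_isField.Build residue_field residue_mulVf residue_inv0.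

End ValuationTheory.

Section ValuedFields.
Context {R : realType}.
Implicit Types K L : fieldType.

(** A set of field elements is a subfield when it is closed under [1], [-]
    and [/]. *)
Definition subfield L (A : set L) : Prop := divring_closed (mem A).

Definition generated_subfield L (A : set L) : set L :=
  \bigcap_(B in [set B | subfield B /\ A `<=` B]) B.

(** [F(s)] *)
Definition adjoin L (F : set L) (s : L) : set L :=
  generated_subfield (F `|` [set s]).

(** The zero of [F] does not contribute since [v 0 = +oo]. *)
Definition value_group L (v : valuation R L) (F : set L) : set R :=
  [set g | exists2 x, F x & v x = g%:E].

(** The value group is isomorphic to [int]. With [v] normalised or not, this
    says that [valuation_ring v] is a DVR with quotient field [K]. *)
Definition discrete_valuation K (v : valuation R K) : Prop :=
  exists2 g : R, g != 0 & value_group v [set: K] = range (fun n : int => g *~ n).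

Definition perfect_field K : Prop :=
  forall p : {poly K}, irreducible_poly p -> separable_poly p.

Definition valuation_closure L (v : valuation R L) (A : set L) : set L :=
  [set x | forall r : R, exists2 y, A y & (r%:E <= v (x - y)%R)%E].

Definition valuation_complete L (v : valuation R L) : Prop :=
  forall u : nat -> L,
    (forall r : R, exists N, forall m n, (N <= m)%N -> (N <= n)%N ->
       (r%:E <= v (u m - u n)%R)%E) ->
  exists x, forall r : R, exists N, forall n, (N <= n)%N ->
    (r%:E <= v (u n - x)%R)%E.

(** [(L, w)] is the completion of [(K, v)] along the embedding [f]. *)
Definition is_completion K L (v : valuation R K) (w : valuation R L)
    (f : {rmorphism K -> L}) : Prop :=
  [/\ forall x, w (f x) = v x,
      valuation_closure w (range f) = [set: L] &
      valuation_complete w].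

(** The index of [H] in [G], i.e. the number of cosets [g + H] with [g] in
    [G]; [None] stands for infinity. *)
Definition subgroup_index (G H : set R) : option nat :=
  let cosets := [set [set g + h | h in H] | g in G] in
  if `[< finite_set cosets >] then Some #|` fset_set cosets|%fset else None.

(** [e(E | F)] *)
Definition ramification_index L (v : valuation R L) (F E : set L) : option nat :=
  subgroup_index (value_group v E) (value_group v F).

(** The residue field of the subfield [F], as a subfield of that of [L]. *)
Definition residue_subfield L (v : valuation R L) (F : set L) :
    set (residue_field v) :=
  [set residue x | x in [set x : valuation_ring v | F (val x)]].
Arguments residue_subfield [L] v F _.

Definition separable_extension L (F E : set L) : Prop :=
  forall a, E a -> exists p : {poly L},
    [/\ p \is a polyOver (mem F), separable_poly p & root p a].

Definition finite_extension L (F E : set L) : Prop :=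
  [/\ subfield E, F `<=` E &
      exists n (b : 'I_n -> L),
        E = [set \sum_i c i * b i | c in [set c | forall i, F (c i)]]].

Definition unramified L (v : valuation R L) (F E : set L) : Prop :=
  ramification_index v F E = Some 1%N /\
  separable_extension (residue_subfield v F) (residue_subfield v E).

(** [F^ur] inside the algebraically closed field [L]: the compositum of the
    finite unramified extensions of [F] in [L]. *)
Definition maximal_unramified L (v : valuation R L) (F : set L) : set L :=
  generated_subfield
    (\bigcup_(E in [set E | finite_extension F E /\ unramified v F E]) E).

(** The elements [s] of [L] with finite ramification index [e(F(s) | F)]. *)
Definition bounded_ramification L (v : valuation R L) (F : set L) : set L :=
  [set s | ramification_index v F (adjoin F s) <> None].

End ValuedFields.

(* Main.v *)
Require Import Defs.
From HB Require Import structures.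
From mathcomp Require Import all_boot all_order all_algebra separable finmap.
From mathcomp Require Import generic_quotient.
From mathcomp Require Import boolp classical_sets functions cardinality.
From mathcomp Require Import reals constructive_ereal.
From mathcomp Require Import ring lra zify.
Import Defs.
Import Order.TTheory GRing.Theory Num.Theory.
Set Implicit Arguments.
Unset Strict Implicit.
Unset Printing Implicit Defensive.
Local Open Scope classical_set_scope.
Local Open Scope ring_scope.

(** Write [C] for the completed algebraic closure and [A] for the closed copy
    of the complete base field inside it. Call an integral [a] in [C] étale
    when it is a root of a monic integral polynomial over [A] whose derivative
    at [a] is a unit, and let the hull of a subfield [F] containing [A] be the
    field generated by [F] and all étale elements.

    Perfectness of the residue field makes every residue of [C] the residue of
    an étale element ([etale_lift]). Hensel's lemma shows that adjoining étale
    elements to a closed subfield creates no new values ([etale_extension],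
    [value_group_etale_hull]). Expanding digit by digit, with étale elements as
    digits, shows that a closed field with the same values as a subfield [F]
    lies in the closure of the hull of [F] ([approx_closure],
    [unramified_sub_hull]). Hence, for [F] finite over [A], the maximal
    unramified extension and the hull of [F] have the same closure, whose value
    group is that of [F] and so has finite index over that of [A]. All elements
    of this closure therefore have finite ramification.

    Conversely let [x] have finite ramification, let [M] be the closure of the
    hull of [A] and [N] that of the hull of the closure of [A(x)]. Both have
    the residue field of [C], and the value group of [N] is a finite extension
    of that of [M]; digit expansions show that finitely many elements span a
    dense [M]-subspace of [N]. Finite-dimensional spaces over closed subfields
    are closed ([linear_span_closed]), so [N] is finite over [M] and [x] is a
    root of some polynomial [g] over [M] ([bounded_ramification_algebraic]).
    One concludes by induction on the degree of [g]:
    - if [g'(x) <> 0], choose [b] algebraic over [A] and close to [x]; Newton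
      iteration for [g] from [b] converges to [x] and stays in the closure of
      the hull of [A(b)] ([simple_root_in_finite_hull]);
    - if [g'(x) = 0] with [g' <> 0], replace [g] by [g'];
    - if [g' = 0], then [g] is a polynomial in [X^p], the induction applies to
      [x^p], and adjoining a [p]-th root of a uniformizer of the finite
      extension found for [x^p] captures [x] ([pchar_root_in_finite_hull]). *)

(** * Estimates for a valuation *)

Section Valuation.
Context {R : realType} {L : fieldType} (v : valuation R L).
Implicit Types (r s : R) (x y : L).

(** Bounds with a real right-hand side, which avoid case distinctions on the
    value [+oo] of 0. *)
Definition val_ge r x := (r%:E <= v x)%E.

Lemma val_ge0 r : val_ge r 0.
Proof. by rewrite /val_ge val0 leey. Qed.

Lemma val_ge1 : val_ge 0 1.
Proof. by rewrite /val_ge val1. Qed.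

Lemma val_ge_le r s x : r <= s -> val_ge s x -> val_ge r x.
Proof. by move=> rs; apply: le_trans; rewrite lee_fin. Qed.

Lemma val_geD r x y : val_ge r x -> val_ge r y -> val_ge r (x + y).
Proof. by move=> hx hy; apply: le_trans (valD _ _ _); rewrite le_min; apply/andP. Qed.

Lemma val_geN r x : val_ge r (- x) = val_ge r x.
Proof. by rewrite /val_ge valN. Qed.

Lemma val_geB r x y : val_ge r x -> val_ge r y -> val_ge r (x - y).
Proof. by move=> hx hy; apply: val_geD => //; rewrite val_geN. Qed.

Lemma val_geBC r x y : val_ge r (x - y) = val_ge r (y - x).
Proof. by rewrite -val_geN opprB. Qed.

Lemma val_ge_trans r y x z : val_ge r (x - y) -> val_ge r (y - z) -> val_ge r (x - z).
Proof. by move=> h1 h2; rewrite -(subrK y x) -addrA; apply: val_geD. Qed.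

Lemma val_geM r s x y : val_ge r x -> val_ge s y -> val_ge (r + s) (x * y).
Proof. by move=> hx hy; rewrite /val_ge valM EFinD; apply: leeD. Qed.

Lemma val_ge0M r x y : val_ge 0 x -> val_ge r y -> val_ge r (x * y).
Proof. by move=> hx hy; rewrite -[r]add0r; apply: val_geM. Qed.

Lemma val_ge_sum r (I : Type) (s : seq I) (P : pred I) (F : I -> L) :
  (forall i, P i -> val_ge r (F i)) -> val_ge r (\sum_(i <- s | P i) F i).
Proof.
by move=> h; elim/big_ind: _ => //; [exact: val_ge0 | move=> *; exact: val_geD].
Qed.

Lemma val_geX r x n : val_ge r x -> val_ge (r *+ n) (x ^+ n).
Proof.
move=> hx; elim: n => [|n IH]; first by rewrite expr0 mulr0n; exact: val_ge1.
by rewrite exprS mulrS; apply: val_geM.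
Qed.

Lemma val_ge0X x n : val_ge 0 x -> val_ge 0 (x ^+ n).
Proof. by move=> /val_geX-/(_ n); rewrite mul0rn. Qed.

Lemma val_finE x : x != 0 -> exists r, v x = r%:E.
Proof. by move=> /(val_fin v); case: (v x) => // r _; exists r. Qed.

Lemma val_finP x r : v x = r%:E -> x != 0.
Proof. by move=> h; apply/eqP => x0; move: h; rewrite x0 val0. Qed.

Lemma val_ge_ex x : exists r, val_ge r x.
Proof.
have [->|/val_finE [r hr]] := eqVneq x 0; first by exists 0; exact: val_ge0.
by exists r; rewrite /val_ge hr.
Qed.

Lemma val_ge_eq0 x : (forall r, val_ge r x) -> x = 0.
Proof.
move=> h; apply/eqP/negP => /negP/val_finE [r hr].
by have := h (r + 1); rewrite /val_ge hr lee_fin -subr_ge0 opprD addrA subrr sub0r oppr_ge0 ler10.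
Qed.

Lemma val_eq_ge r x : v x = r%:E -> val_ge r x.
Proof. by rewrite /val_ge => ->. Qed.

Lemma val_eqV r x : v x = r%:E -> v x^-1 = (- r)%:E.
Proof.
move=> hx; have x0 := val_finP hx.
have [s hs] := val_finE (invr_neq0 x0).
have := valM v x x^-1; rewrite divff // val1 hx hs => -[] /esym/eqP.
by rewrite addrC addr_eq0 => /eqP ->.
Qed.

Lemma val_eqM r s x y : v x = r%:E -> v y = s%:E -> v (x * y) = (r + s)%:E.
Proof. by move=> hx hy; rewrite valM hx hy. Qed.

Lemma val_eqX r x n : v x = r%:E -> v (x ^+ n) = (r *+ n)%:E.
Proof.
move=> hx; elim: n => [|n IH]; first by rewrite expr0 mulr0n val1.
by rewrite exprS mulrS; apply: val_eqM.
Qed.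

Lemma val_eqX_div r x n : v (x ^+ n.+1) = (r *+ n.+1)%:E -> v x = r%:E.
Proof.
move=> hx; have [s hs] : exists s, v x = s%:E.
  by apply: val_finE; apply: contraTneq (val_finP hx) => ->; rewrite expr0n negbK.
rewrite hs; congr (_%:E); have := val_eqX n.+1 hs; rewrite hx => -[] /eqP.
by rewrite eqrMn2r => /eqP.
Qed.

Lemma val_eq_near r x y : v x = r%:E -> (r%:E < v (x - y)%R)%E -> v y = r%:E.
Proof.
move=> hx h; apply/eqP; rewrite eq_le; apply/andP; split; last first.
  have := valB v x (x - y); rewrite opprB addrCA subrr addr0 hx.
  by apply: le_trans; rewrite le_min lexx ltW.
rewrite leNgt; apply/negP => hy.
by have := valD v (x - y) y; rewrite subrK hx leNgt lt_min h hy.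
Qed.

Lemma val_eq_near_ge r s x y : v x = r%:E -> r < s -> val_ge s (x - y) -> v y = r%:E.
Proof.
by move=> hx rs h; apply: val_eq_near hx _; apply: lt_le_trans h; rewrite lte_fin.
Qed.

Lemma val_gt_ge r x : (r%:E < v x)%E -> exists2 s, r < s & val_ge s x.
Proof.
have [->|/val_finE [s hs]] := eqVneq x 0.
  by move=> _; exists (r + 1); rewrite ?ltrDl ?ltr01 //; exact: val_ge0.
by rewrite hs lte_fin => rs; exists s => //; exact: val_eq_ge.
Qed.

Lemma val_ge_gt r s x : r < s -> val_ge s x -> (r%:E < v x)%E.
Proof. by move=> rs; apply: lt_le_trans; rewrite lte_fin. Qed.

Lemma val_gt0D x y : (0%E < v x)%E -> (0%E < v y)%E -> (0%E < v (x + y)%R)%E.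
Proof. by move=> hx hy; apply: lt_le_trans (Defs.valD _ _ _); rewrite lt_min hx. Qed.

Lemma val_gt0M x y : val_ge 0 x -> (0%E < v y)%E -> (0%E < v (x * y)%R)%E.
Proof.
by move=> hx /val_gt_ge [s s0 hy]; apply: (val_ge_gt s0); apply: val_ge0M.
Qed.

Lemma val_unit x : (0%:E <= v x)%E -> ~~ (0%:E < v x)%E -> v x = 0%:E.
Proof. by move=> h1 h2; apply/eqP; rewrite eq_le h1 leNgt h2. Qed.

End Valuation.

(** * Subfields, closures and value groups *)

Section Subfields.
Context {L : fieldType}.
Implicit Types (A B : set L) (x y : L).

Lemma subfield_intro A : A 1 -> (forall x y, A x -> A y -> A (x - y)) ->
  (forall x y, A x -> A y -> y != 0 -> A (x / y)) -> subfield A.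
Proof.
move=> h1 hB hV; split=> [|x y|x y]; rewrite !inE //; first exact: hB.
move=> hx hy; have [->|y0] := eqVneq y 0; last exact: hV.
by rewrite invr0 mulr0 -(subrr 1); apply: hB.
Qed.

Section Closed.
Variables (A : set L) (hA : subfield A).

Lemma subfield1 : A 1.
Proof. by have [] := hA; rewrite inE. Qed.

Lemma subfieldB x y : A x -> A y -> A (x - y).
Proof. by have [_ h _] := hA; have := h x y; rewrite !inE. Qed.

Lemma subfield_div x y : A x -> A y -> A (x / y).
Proof. by have [_ _ h] := hA; have := h x y; rewrite !inE. Qed.

Lemma subfield0 : A 0.
Proof. by rewrite -(subrr 1); apply: subfieldB subfield1 subfield1. Qed.

Lemma subfieldN x : A x -> A (- x).
Proof. by move=> hx; rewrite -sub0r; apply: subfieldB subfield0 hx. Qed.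

Lemma subfieldD x y : A x -> A y -> A (x + y).
Proof. by move=> hx hy; rewrite -(opprK y); apply: subfieldB => //; exact: subfieldN. Qed.

Lemma subfieldV x : A x -> A x^-1.
Proof. by move=> hx; rewrite -div1r; apply: subfield_div subfield1 hx. Qed.

Lemma subfieldM x y : A x -> A y -> A (x * y).
Proof. by move=> hx hy; rewrite -(invrK y); apply: subfield_div => //; exact: subfieldV. Qed.

Lemma subfieldX x n : A x -> A (x ^+ n).
Proof.
move=> hx; elim: n => [|n IH]; first by rewrite expr0; exact: subfield1.
by rewrite exprS; exact: subfieldM.
Qed.

Lemma subfield_sum (I : Type) (s : seq I) (P : pred I) (F : I -> L) :
  (forall i, P i -> A (F i)) -> A (\sum_(i <- s | P i) F i).
Proof.
by move=> h; elim/big_ind: _ => //; [exact: subfield0 | move=> *; exact: subfieldD].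
Qed.

Lemma subfield_horner (p : {poly L}) x : (forall i, A p`_i) -> A x -> A p.[x].
Proof.
by move=> hp hx; rewrite horner_coef; apply: subfield_sum => i _; apply: subfieldM => //; exact: subfieldX.
Qed.

End Closed.

(** Polynomial division and matrices need a coefficient field that is a type. *)
Definition subfield_mem A of subfield A : {pred L} := mem A.

HB.instance Definition _ A (hA : subfield A) :=
  GRing.isDivringClosed.Build L (@subfield_mem A hA) hA.

Definition subfield_type A (hA : subfield A) : Type := {x : L | x \in subfield_mem hA}.

HB.instance Definition _ A (hA : subfield A) := SubType.on (subfield_type hA).
HB.instance Definition _ A (hA : subfield A) := Choice.on (subfield_type hA).
HB.instance Definition _ A (hA : subfield A) :=
  [SubChoice_isSubIntegralDomain of subfield_type hA by <:].
HB.instance Definition _ A (hA : subfield A) :=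
  [SubIntegralDomain_isSubField of subfield_type hA by <:].

Lemma subfield_as_range A : subfield A ->
  exists (F : fieldType) (f : {rmorphism F -> L}), range f = A.
Proof.
move=> hA; exists (subfield_type hA), (val : {rmorphism _ -> _}).
apply/seteqP; split=> [x [y _ <-]|x hx]; first by have := valP y; rewrite inE.
have hx' : x \in subfield_mem hA by rewrite inE.
by exists (Sub x hx').
Qed.

Lemma generated_subfieldP A : subfield (generated_subfield A).
Proof.
apply: subfield_intro => [B [hB _]|x y hx hy B [hB AB]|x y hx hy _ B [hB AB]].
- exact: subfield1.
- by apply: subfieldB; [|apply: hx|apply: hy].
by apply: subfield_div; [|apply: hx|apply: hy].
Qed.

Lemma sub_generated_subfield A : A `<=` generated_subfield A.
Proof. by move=> x hx B [_]; exact. Qed.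

Lemma generated_subfield_sub A B : subfield B -> A `<=` B -> generated_subfield A `<=` B.
Proof. by move=> hB AB x; apply; split. Qed.

Lemma subfield_setI A B : subfield A -> subfield B -> subfield (A `&` B).
Proof.
move=> hA hB; apply: subfield_intro => [|x y [Ax Bx] [Ay By]|x y [Ax Bx] [Ay By] _].
- by split; exact: subfield1.
- by split; exact: subfieldB.
by split; exact: subfield_div.
Qed.

End Subfields.

Section Morphisms.
Variables (F L : fieldType) (f : {rmorphism F -> L}).

Lemma range_subfield : subfield (range f).
Proof.
apply: subfield_intro => [|_ _ [x _ <-] [y _ <-]|_ _ [x _ <-] [y _ <-] _].
- by exists 1; rewrite // rmorph1.
- by exists (x - y); rewrite // rmorphB.
by exists (x / y); rewrite // rmorphM fmorphV.
Qed.

Lemma image_subfield (B : set F) : subfield B -> subfield (f @` B).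
Proof.
move=> hB; apply: subfield_intro => [|_ _ [x hx <-] [y hy <-]|_ _ [x hx <-] [y hy <-] _].
- by exists 1; [exact: subfield1|rewrite rmorph1].
- by exists (x - y); [exact: subfieldB|rewrite rmorphB].
by exists (x / y); [exact: subfield_div|rewrite rmorphM fmorphV].
Qed.

Lemma preimage_subfield (A : set L) : subfield A -> subfield (f @^-1` A).
Proof.
move=> hA; apply: subfield_intro => [|x y|x y] /=.
- by rewrite rmorph1; exact: subfield1.
- by rewrite rmorphB; exact: subfieldB.
by move=> hx hy _; rewrite rmorphM fmorphV; exact: subfield_div.
Qed.

End Morphisms.

Section Closure.
Context {R : realType} {L : fieldType} (v : valuation R L).
Implicit Types (A B : set L) (x y : L).
Local Notation clos := (valuation_closure v).

Lemma sub_closure A : A `<=` clos A.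
Proof. by move=> x hx r; exists x; rewrite // subrr val0 leey. Qed.

Lemma closure_subset A B : A `<=` B -> clos A `<=` clos B.
Proof. by move=> AB x hx r; have [y /AB] := hx r; exists y. Qed.

Lemma closure_idem A : clos (clos A) `<=` clos A.
Proof.
move=> x hx r; have [y hy xy] := hx r; have [z hz yz] := hy r.
by exists z => //; exact: val_ge_trans xy yz.
Qed.

Lemma closure_approx A x r : clos A x -> v x = r%:E ->
  exists2 y, A y & v y = r%:E.
Proof.
move=> hx vx; have [y hy xy] := hx (r + 1); exists y => //.
by apply: val_eq_near_ge vx _ xy; rewrite ltrDl.
Qed.

Lemma val_ge_inv_sub x y r s : v x = r%:E -> v y = r%:E -> val_ge v s (x - y) ->
  val_ge v (s - r - r) (x^-1 - y^-1).
Proof.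
move=> vx vy h; have x0 := val_finP vx; have y0 := val_finP vy.
have -> : x^-1 - y^-1 = (y - x) * x^-1 * y^-1.
  by rewrite mulrAC !mulrBl divff // mul1r (mulrC x) -mulrA divff // mulr1.
apply: val_geM; last by apply: val_eq_ge; exact: val_eqV.
by apply: val_geM; [rewrite val_geBC | apply: val_eq_ge; exact: val_eqV].
Qed.

Lemma closure_subfield A : subfield A -> subfield (clos A).
Proof.
move=> hA; have hM x y : clos A x -> clos A y -> clos A (x * y).
  move=> hx hy r; have [a ha] := val_ge_ex v y; have [x' hx' xx'] := hx (r - a).
  have [b hb] := val_ge_ex v x'; have [y' hy' yy'] := hy (r - b).
  exists (x' * y'); first exact: subfieldM.
  have -> : x * y - x' * y' = (x - x') * y + x' * (y - y').
    by rewrite mulrBl mulrBr addrA subrK.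
  apply: val_geD; first by rewrite -[r](subrK a); exact: val_geM.
  by rewrite -[r](subrK b) addrC; exact: val_geM.
apply: subfield_intro => [|x y hx hy r|x y hx hy y0].
- by apply: sub_closure; exact: subfield1.
- have [x' hx' xx'] := hx r; have [y' hy' yy'] := hy r.
  exists (x' - y'); first exact: subfieldB.
  by rewrite opprD addrACA -opprD; apply: val_geB.
apply: hM => // r; have [s vy] := val_finE v y0.
have [y' hy' yy'] := hy (Num.max (s + 1) (r + s + s)).
exists y'^-1; first exact: subfieldV.
have vy' : v y' = s%:E.
  apply: val_eq_near_ge vy _ yy'; apply: (@lt_le_trans _ _ (s + 1)); first by rewrite ltrDl.
  by rewrite le_max lexx.
apply: (@val_ge_le _ _ _ _ (r + s + s - s - s)); first by rewrite !addrK.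
by apply: (val_ge_inv_sub vy vy'); apply: val_ge_le yy'; rewrite le_max lexx orbT.
Qed.

Lemma value_group_subset A B : A `<=` B -> value_group v A `<=` value_group v B.
Proof. by move=> AB g [x /AB]; exists x. Qed.

Lemma value_group_closure A : value_group v (clos A) = value_group v A.
Proof.
apply/seteqP; split; last exact/value_group_subset/sub_closure.
by move=> g [x hx vx]; have [y] := closure_approx hx vx; exists y.
Qed.

Lemma value_group0 A : subfield A -> value_group v A 0.
Proof. by move=> /subfield1; exists 1; rewrite ?val1. Qed.

Lemma value_groupD A g h : subfield A ->
  value_group v A g -> value_group v A h -> value_group v A (g + h).
Proof.
move=> hA [x hx vx] [y hy vy]; exists (x * y); first exact: subfieldM.
exact: val_eqM.
Qed.

Lemma value_groupN A g : subfield A -> value_group v A g -> value_group v A (- g).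
Proof.
move=> hA [x hx vx]; exists x^-1; first exact: subfieldV.
exact: val_eqV.
Qed.

Lemma value_groupB A g h : subfield A ->
  value_group v A g -> value_group v A h -> value_group v A (g - h).
Proof. by move=> hA hg hh; apply: value_groupD => //; exact: value_groupN. Qed.

Lemma value_groupMz A g (n : int) : subfield A ->
  value_group v A g -> value_group v A (g *~ n).
Proof.
move=> hA hg; have hN m : value_group v A (g *+ m).
  elim: m => [|m IH]; first by rewrite mulr0n; exact: value_group0.
  by rewrite mulrS; exact: value_groupD.
by case: n => m; [exact: hN | rewrite NegzE mulrNz; apply: value_groupN => //; exact: hN].
Qed.

End Closure.

(** * Finite extensions *)

Section FieldExtensions.
Context {L : fieldType}.
Implicit Types (A B : set L) (x y : L).

Definition linear_span A n (b : 'I_n -> L) : set L :=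
  [set \sum_i c i * b i | c in [set c | forall i, A (c i)]].

Definition algebraic_over A x :=
  exists p : {poly L}, [/\ p != 0, forall i, A p`_i & root p x].

Lemma algebraic_over_subset A B x : A `<=` B -> algebraic_over A x -> algebraic_over B x.
Proof. by move=> AB [p [p0 hp px]]; exists p; split=> // i; apply: AB. Qed.

Lemma linear_spanB A n (b : 'I_n -> L) x y : subfield A ->
  linear_span A b x -> linear_span A b y -> linear_span A b (x - y).
Proof.
move=> hA [c hc <-] [d hd <-]; exists (fun i => c i - d i).
  by move=> i; apply: subfieldB.
by rewrite -sumrB; apply: eq_bigr => i _; rewrite mulrBl.
Qed.

Lemma linear_span_scale A n (b : 'I_n -> L) a x : subfield A ->
  A a -> linear_span A b x -> linear_span A b (a * x).
Proof.
move=> hA ha [c hc <-]; exists (fun i => a * c i).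
  by move=> i; apply: subfieldM.
by rewrite mulr_sumr; apply: eq_bigr => i _; rewrite mulrA.
Qed.

Lemma linear_span_gen A n (b : 'I_n -> L) i : subfield A -> linear_span A b (b i).
Proof.
move=> hA; exists (fun j => (j == i)%:R).
  by move=> j; case: eqP => _; [exact: subfield1|exact: subfield0].
rewrite (bigD1 i) //= eqxx mul1r big1 ?addr0 // => j /negbTE ->.
by rewrite mul0r.
Qed.

Lemma linear_span_sub A E n (b : 'I_n -> L) : subfield E -> A `<=` E ->
  (forall i, E (b i)) -> linear_span A b `<=` E.
Proof.
move=> hE AE hb _ [c hc <-]; apply: subfield_sum => // i _.
by apply: subfieldM => //; apply: AE.
Qed.

(** The products of the two spanning families span. *)
Lemma finite_extension_tower A E F : finite_extension A E -> finite_extension E F ->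
  finite_extension A F.
Proof.
move=> [hE AE [n [b Eb]]] [hF EF [m [d Fd]]]; split=> //; first exact: subset_trans EF.
pose N := #|{: 'I_n * 'I_m}|; pose e (k : 'I_N) := b (enum_val k).1 * d (enum_val k).2.
have reindexE (c : 'I_N -> L) : \sum_k c k * e k =
    \sum_j (\sum_i c (enum_rank (i, j)) * b i) * d j.
  under [RHS]eq_bigr do rewrite mulr_suml.
  rewrite exchange_big /= pair_big /= (reindex (@enum_rank _)) /=; last first.
    by exists enum_val => k _; rewrite ?enum_rankK ?enum_valK.
  by apply: eq_bigr => -[i j] _; rewrite /e !enum_rankK /= mulrA.
have Eb' x : E x <-> linear_span A b x by rewrite Eb.
exists N, e; rewrite Fd; apply/seteqP; split=> x.
- move=> [c hc <-].
  have /choice [a ha] : forall j, exists a : 'I_n -> L,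
      (forall i, A (a i)) /\ \sum_i a i * b i = c j.
    by move=> j; have /Eb' [a ha <-] := hc j; exists a.
  exists (fun k => a (enum_val k).2 (enum_val k).1) => [k|]; first exact: (ha _).1.
  rewrite reindexE; apply: eq_bigr => j _; congr (_ * _).
  by rewrite -(ha j).2; apply: eq_bigr => i _; rewrite enum_rankK.
move=> [c hc <-]; rewrite reindexE.
exists (fun j => \sum_i c (enum_rank (i, j)) * b i) => // j.
by apply/Eb'; exists (fun i => c (enum_rank (i, j))).
Qed.

End FieldExtensions.

Section Algebraic.
Variables (F L : fieldType) (f : {rmorphism F -> L}).
Implicit Types (x y : L).

Lemma map_poly_range (p : {poly L}) : (forall i, range f p`_i) ->
  exists q : {poly F}, map_poly f q = p.
Proof.
move=> hp; have /choice [c hc] : forall i, exists a, f a = p`_i.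
  by move=> i; have [a _ <-] := hp i; exists a.
exists (\poly_(i < size p) c i); apply/polyP => i.
rewrite coef_map coef_poly; case: ltnP => [_|/leq_sizeP->//]; first exact: hc.
by rewrite raddf0.
Qed.

Lemma algebraic_rangeP x : algebraic_over (range f) x <-> algebraicOver f x.
Proof.
split=> [[p [p0 /map_poly_range [q qp] px]]|[p p0 px]].
  by exists q; rewrite ?qp // -(map_poly_eq0 f) qp.
exists (map_poly f p); split=> //; first by rewrite map_poly_eq0.
by move=> i; rewrite coef_map; exists p`_i.
Qed.

(** Divide a polynomial relation by [x] until its constant term is nonzero;
    then solve for the inverse. *)
Lemma algebraic_inv_horner x : algebraicOver f x -> x != 0 ->
  exists p : {poly F}, x^-1 = (map_poly f p).[x].
Proof.
move=> [p p0 px] x0; elim: (size p) {-2}p (leqnn (size p)) p0 px => [|n IH] {}p.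
  by rewrite leqn0 size_poly_eq0 => ->.
elim/poly_ind: p => [_ /eqP //|q c _].
rewrite size_MXaddC => hs p0; rewrite /root rmorphD rmorphM /= map_polyX map_polyC hornerMXaddC.
have [c0|c0] := eqVneq c 0.
  have q0 : q != 0 by apply: contraNneq p0 => ->; rewrite c0 mul0r addr0.
  rewrite c0 raddf0 addr0 mulf_eq0 (negbTE x0) orbF => qx; apply: (IH q _ q0 qx).
  by move: hs; rewrite (negbTE q0).
rewrite addr_eq0 => /eqP qx; exists (- c^-1 *: q).
rewrite map_polyZ hornerZ raddfN /= fmorphV; apply: (mulIf x0).
by rewrite mulVf // -mulrA qx mulrNN mulVf // fmorph_eq0.
Qed.

(** The values at [x] of polynomials form a field because inverses of
    algebraic elements are polynomials in them; division by [h] bounds degrees. *)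
Lemma simple_extension (h : {poly F}) x : h != 0 -> root (map_poly f h) x ->
  let E := range (fun q => (map_poly f q).[x]) in
  [/\ finite_extension (range f) E, E x &
      forall y, E y -> exists2 q : {poly F}, (size q < size h)%N & y = (map_poly f q).[x]].
Proof.
move=> h0 hx E; have algx : integralOver f x by apply/integral_algebraic; exists h.
have small y : E y -> exists2 q : {poly F}, (size q < size h)%N & y = (map_poly f q).[x].
  move=> [q _ <-]; exists (q %% h); first by rewrite ltn_modp.
  by rewrite {1}(divp_eq q h) rmorphD rmorphM hornerD hornerM (eqP hx) mulr0 add0r.
have fE : range f `<=` E.
  by move=> _ [a _ <-]; exists a%:P; rewrite // map_polyC hornerC.
have hE : subfield E.
  apply: subfield_intro; first by exists 1; rewrite // rmorph1 hornerC.
    by move=> _ _ [p _ <-] [q _ <-]; exists (p - q); rewrite // rmorphB hornerD hornerN.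
  move=> _ _ [p _ <-] [q _ <-] q0.
  have [|r ->] := algebraic_inv_horner _ q0.
    apply/integral_algebraic/integral_horner => // c /(nthP 0) [i _ <-].
    by rewrite coef_map; exact: integral_id.
  by exists (p * (r \Po q)); rewrite // rmorphM /= hornerM map_comp_poly horner_comp.
split=> //; last by exists 'X; rewrite // map_polyX hornerX.
split=> //; exists (size h), (fun i : 'I__ => x ^+ i); apply/seteqP; split=> y.
  move=> /small [q qh ->]; exists (fun i : 'I__ => f q`_i); first by move=> i; exists q`_i.
  rewrite (horner_coef_wide _ (n := size h)); last by rewrite size_map_poly ltnW.
  by apply: eq_bigr => i _; rewrite coef_map.
have Ex : E x by exists 'X; rewrite // map_polyX hornerX.
by apply: linear_span_sub => // i; exact: subfieldX.
Qed.

Lemma linear_span_dependent n (b : 'I_n -> L) (y : 'I_n.+1 -> L) :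
  (forall i, linear_span (range f) b (y i)) ->
  exists c : 'I_n.+1 -> F, (exists i, c i != 0) /\ \sum_i f (c i) * y i = 0.
Proof.
move=> hy; have /choice [a ha] : forall i, exists a : 'I_n -> F,
    \sum_j f (a j) * b j = y i.
  move=> i; have [c hc <-] := hy i.
  have /choice [a ha] : forall j, exists a, f a = c j.
    by move=> j; have [z _ <-] := hc j; exists z.
  by exists a; apply: eq_bigr => j _; rewrite ha.
pose A : 'M[F]_(n.+1, n) := \matrix_(i, j) a i j.
have : kermx A != 0.
  by rewrite kermx_eq0 /row_free neq_ltn ltnS rank_leq_col.
move=> /rowV0Pn [u /sub_kermxP uA u0].
exists (u 0); split.
  by apply/not_existsP => h; case/eqP: u0; apply/rowP => i; rewrite mxE; apply/eqP/negPn/negP/h.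
under eq_bigr do rewrite -ha mulr_sumr.
rewrite exchange_big /= big1 // => j _.
have /rowP/(_ j) := uA; rewrite !mxE => /(congr1 f); rewrite raddf0 raddf_sum => uAj.
transitivity ((\sum_i f (u 0 i * A i j)) * b j); last by rewrite uAj mul0r.
rewrite mulr_suml; apply: eq_bigr => i _.
by rewrite rmorphM mxE mulrA.
Qed.

End Algebraic.

Section Adjunction.
Context {L : fieldType}.
Implicit Types (A E : set L) (x : L).

Lemma finite_extension_refl A : subfield A -> finite_extension A A.
Proof.
move=> hA; split=> //; exists 1%N, (fun=> 1); apply/seteqP; split=> x.
  by move=> hx; exists (fun=> x) => //; rewrite big_ord1 mulr1.
by apply: linear_span_sub => // i; exact: subfield1.
Qed.

Lemma finite_extension_adjoin A E x : finite_extension A E -> algebraic_over A x ->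
  exists E', [/\ finite_extension A E', E `<=` E' & E' x].
Proof.
move=> hE ax; have [sE AE _] := hE; have [F [f fE]] := subfield_as_range sE.
have /algebraic_rangeP [h h0 hx] : algebraic_over (range f) x.
  by rewrite fE; apply: algebraic_over_subset AE ax.
have [hE' E'x _] := simple_extension h0 hx.
rewrite fE in hE'; eexists; split; [exact: finite_extension_tower hE hE' | | exact: E'x].
by case: hE'.
Qed.

(** Too many powers of [x] in a finite-dimensional space are dependent. *)
Lemma linear_span_algebraic A n (b : 'I_n -> L) x : subfield A ->
  (forall i, linear_span A b (x ^+ i)) -> algebraic_over A x.
Proof.
move=> hA hx; have [F [f fA]] := subfield_as_range hA.
have [|c [[i ci] hc]] := @linear_span_dependent _ _ f n b (fun i => x ^+ i).
  by move=> i; rewrite fA.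
rewrite -fA; apply/algebraic_rangeP; exists (\poly_(i < n.+1) c (inord i)).
  by apply: contraNneq ci => /polyP/(_ i); rewrite coef_poly ltn_ord inord_val coef0 => ->.
rewrite /root (horner_coef_wide _ (n := n.+1)); last first.
  by rewrite size_map_poly size_poly.
rewrite -[X in _ == X]hc; apply/eqP; apply: eq_bigr => j _.
by rewrite coef_map coef_poly ltn_ord inord_val.
Qed.

Lemma finite_extension_algebraic A E x : subfield A -> finite_extension A E -> E x ->
  algebraic_over A x.
Proof.
move=> hA [hE _ [n [b Eb]]] Ex; apply: (@linear_span_algebraic _ n b) => // i.
by rewrite /linear_span -Eb; exact: subfieldX.
Qed.

End Adjunction.

(** * Finite-dimensional spaces over closed subfields *)

Section CompleteValuation.
Context {R : realType} {L : fieldType} (v : valuation R L).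
Hypothesis v_complete : valuation_complete v.
Implicit Types (A E : set L) (x y : L).
Local Notation clos := (valuation_closure v).

Lemma ler_linear (a e r : R) : 0 < e -> exists n, r <= a + e *+ n.
Proof.
move=> e0; exists (Num.trunc ((r - a) / e)).+1.
by rewrite -lerBlDl -mulr_natr -ler_pdivrMl // mulrC ltW // truncnS_gt.
Qed.

Lemma cauchy_limit (u : nat -> L) (a e : R) : 0 < e ->
  (forall n m, (n <= m)%N -> val_ge v (a + e *+ n) (u n - u m)) ->
  exists x, forall n, val_ge v (a + e *+ n) (u n - x).
Proof.
move=> e0 hu; have huu r : exists N, forall m n, (N <= m)%N -> (N <= n)%N ->
    (r%:E <= v (u m - u n)%R)%E.
  have [N hN] := ler_linear a r e0; exists N => m n Nm Nn; apply: (val_ge_le hN).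
  by apply: (@val_ge_trans _ _ _ _ (u N)); [rewrite val_geBC|]; exact: hu.
have [x hx] := v_complete huu; exists x => n.
have [N hN] := hx (a + e *+ n).
apply: (@val_ge_trans _ _ _ _ (u (maxn n N))); first by apply: hu; exact: leq_maxl.
by apply: hN; exact: leq_maxr.
Qed.

Lemma closure_limit A x (a e : R) : 0 < e ->
  (forall n, exists2 y, A y & val_ge v (a + e *+ n) (x - y)) -> clos A x.
Proof.
move=> e0 h r; have [n hn] := ler_linear a r e0; have [y Ay hy] := h n.
by exists y => //; exact: val_ge_le hn hy.
Qed.

(** Induction on [n]: a vector [b] outside the closed subspace [W] stays away
    from [W], so the coefficient of [b] depends continuously on a vector of
    [W + E b]; hence that space is closed again. *)
Lemma linear_span_closed E n (b : 'I_n -> L) : subfield E -> clos E `<=` E ->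
  clos (linear_span E b) `<=` linear_span E b.
Proof.
move=> hE cE; elim: n b => [|n IH] b x hx.
  have -> : x = 0.
    apply: (val_ge_eq0 (v := v)) => r; have [y [c _ <-]] := hx r.
    by rewrite big_ord0 subr0.
  by exists (fun=> 0) => [[]|]; rewrite ?big_ord0.
pose W := linear_span E (fun i => b (lift ord0 i)); pose b0 := b ord0.
have spanS y : linear_span E b y <-> exists2 c, E c & W (y - c * b0).
  split=> [[c hc <-]|[c hc [d hd]]].
    exists (c ord0) => //; exists (fun i => c (lift ord0 i)); first by move=> i; exact: hc.
    by rewrite big_ord_recl addrC addKr.
  move=> /eqP; rewrite -subr_eq opprK => /eqP <-.
  exists (fun i => if unlift ord0 i is Some j then d j else c).
    by move=> i; case: unliftP.
  rewrite big_ord_recl unlift_none addrC; congr (_ + _).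
  by apply: eq_bigr => i _; rewrite liftK.
have [Wb0|Wb0] := pselect (W b0).
  have subW : linear_span E b `<=` W.
    move=> y /spanS [c hc hy]; have -> : y = (y - c * b0) - (- c) * b0 by rewrite mulNr opprK subrK.
    by apply: linear_spanB => //; apply: linear_span_scale => //; exact: subfieldN.
  apply/spanS; exists 0; first exact: subfield0.
  by rewrite mul0r subr0; apply: IH; apply: closure_subset hx.
have [r hr] : exists r, forall y, W y -> ~ val_ge v r (b0 - y).
  apply/not_existsP => h; apply: Wb0; apply: IH => r.
  by have := h r => /existsNP [y /not_implyP [Wy /contrapT by']]; exists y.
(* the coefficient of [b0] is bounded in terms of the vector *)
have coef_ge c y s : E c -> W y -> val_ge v (s + r) (c * b0 + y) -> val_ge v s c.
  have [->|c0] := eqVneq c 0; first by rewrite /val_ge val0 leey.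
  have [t vc] := val_finE v c0 => hc hy hcy.
   rewrite /val_ge vc lee_fin leNgt; apply/negP => ts.
  have Wy : W (- c^-1 * y) by apply: linear_span_scale => //; apply: subfieldN => //; exact: subfieldV.
  apply: (hr _ Wy); rewrite mulNr opprK.
  have -> : b0 + c^-1 * y = c^-1 * (c * b0 + y) by rewrite mulrDr mulKf.
  apply: (@val_ge_le _ _ _ _ (- t + (s + r))); first by rewrite addrA lerDr addrC subr_ge0 ltW.
  by apply: val_geM => //; apply: val_eq_ge; exact: val_eqV.
have /choice [c hc] : forall n : nat, exists c, E c /\
    exists2 w, W w & val_ge v (1 *+ n + r) (x - (c * b0 + w)).
  move=> m; have [y /spanS [c Ec hw] xy] := hx (1 *+ m + r).
  by exists c; split => //; exists (y - c * b0); rewrite // addrCA subrr addr0.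
have [p q pq|d hd] := @cauchy_limit c 0 1 ltr01.
  have [Ep [w Ww hw]] := hc p; have [Eq [w' Ww' hw']] := hc q.
  rewrite add0r; apply: (coef_ge _ (w - w')); [exact: subfieldB|exact: linear_spanB|].
  have -> : (c p - c q) * b0 + (w - w') = (x - (c q * b0 + w')) - (x - (c p * b0 + w)).
    by ring.
  apply: val_geB => //; apply: val_ge_le hw'.
  by rewrite lerD2r ler_wpMn2l // ler01.
apply/spanS; exists d.
  apply: cE; apply: (@closure_limit _ _ 0 1) => // m; have [Ec _] := hc m.
  by exists (c m) => //; rewrite val_geBC.
apply: IH => s; have [t ht] := val_ge_ex v b0.
have [m1 hm1] := ler_linear r s ltr01.
have [m2 hm2] := ler_linear t s ltr01.
pose m := maxn m1 m2; have [Ec [w Ww hw]] := hc m; exists w => //.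
have -> : x - d * b0 - w = (x - (c m * b0 + w)) + (c m - d) * b0.
  by ring.
apply: val_geD.
  apply: val_ge_le hw; apply: (le_trans hm1); rewrite addrC lerD2r.
  by rewrite ler_wpMn2l ?ler01 ?leq_maxl.
apply: (@val_ge_le _ _ _ _ (0 + 1 *+ m + t)); last by apply: val_geM.
apply: (le_trans hm2); rewrite add0r addrC lerD2r.
by rewrite ler_wpMn2l ?ler01 ?leq_maxr.
Qed.

Lemma finite_extension_closed E F : clos E `<=` E -> subfield E ->
  finite_extension E F -> clos F `<=` F.
Proof. by move=> cE hE [_ _ [n [b ->]]]; exact: linear_span_closed. Qed.

End CompleteValuation.

(** * Value groups of finite extensions *)

Section ValueGroups.
Context {R : realType} {L : fieldType} (v : valuation R L).
Implicit Types (A E : set L) (x y : L) (e g : R) (G H : set R).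
Local Notation clos := (valuation_closure v).

(** In a vanishing sum the minimal valuation is attained at least twice. *)
Lemma sum0_equal_val n (F : 'I_n -> L) i1 : F i1 != 0 -> \sum_i F i = 0 ->
  exists i j, [/\ i != j, F i != 0, F j != 0 & v (F i) = v (F j)].
Proof.
move=> F1 sF; case: (@arg_minP _ _ _ i1 (fun i => F i != 0) (fun i => v (F i)) F1).
move=> i Fi hmin; apply/not_existsP => h; have [t vt] := val_finE v Fi.
have : (t%:E < v (\sum_(j | j != i) F j)%R)%E.
  elim/big_ind: _ => [|x y hx hy|j ji]; first by rewrite val0 ltry.
    by apply: lt_le_trans (Defs.valD _ _ _); rewrite lt_min hx.
  have [->|Fj] := eqVneq (F j) 0; first by rewrite val0 ltry.
  rewrite lt_neqAle -vt hmin // andbT; apply/negP => /eqP vij.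
  by apply: (h i); exists j; split=> //; rewrite eq_sym.
move: sF; rewrite (bigD1 i) //= => /eqP; rewrite addrC addr_eq0 => /eqP ->.
by rewrite valN vt ltxx.
Qed.

(** For [H] infinite cyclic and [G] a group containing it, this is finiteness
    of the index of [H]; unlike cosets it passes to subgroups of [G] at once. *)
Definition bounded_denominators G H :=
  exists2 N, (0 < N)%N & forall g, G g -> H (g *+ N).

(** In a linear relation between powers of [y] two terms have equal value, so
    a multiple of the value of [y] by some [d <= n] is a value of [A]. *)
Lemma value_group_finite_extension A E : subfield A -> finite_extension A E ->
  bounded_denominators (value_group v E) (value_group v A).
Proof.
move=> hA [hE AE [n [b Eb]]]; exists n`!; first exact: fact_gt0.
move=> g [y Ey vy]; have [F [f fA]] := subfield_as_range hA.
have [|c [[i ci] hc]] := @linear_span_dependent _ _ f n b (fun i => y ^+ i).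
  by move=> k; rewrite fA /linear_span -Eb; exact: subfieldX.
have y0 := val_finP vy.
have [|k [m [km]]] := sum0_equal_val (i1 := i) _ hc.
  by rewrite mulf_neq0 ?fmorph_eq0 ?expf_neq0.
wlog lt_km : k m km / (k < m)%N.
  move=> hw h1 h2 h3; move: (km); rewrite neq_ltn => /orP[lt_km|lt_mk].
    exact: (hw k m).
  by apply: (hw m k) => //; rewrite eq_sym.
rewrite !mulf_eq0 !negb_or => /andP[/(val_finE v) [s vs] _] /andP[/(val_finE v) [t vt] _].
rewrite (val_eqM vs (val_eqX _ vy)) (val_eqM vt (val_eqX _ vy)) => -[st].
have dvd : (m - k %| n`!)%N.
  by rewrite dvdn_fact // subn_gt0 lt_km /= (leq_trans (leq_subr _ _)) // -ltnS.
rewrite -(divnK dvd) mulnC mulrnA pmulrn; apply: (value_groupMz _ hA).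
have -> : g *+ (m - k) = s - t.
  by rewrite mulrnBr 1?ltnW //; apply/eqP; rewrite -subr_eq0; apply/eqP; lra.
apply: value_groupB => //; rewrite -fA.
  by exists (f (c k)) => //; exists (c k).
by exists (f (c m)) => //; exists (c m).
Qed.

Lemma bounded_denominators_sub G G' H : G `<=` G' ->
  bounded_denominators G' H -> bounded_denominators G H.
Proof. by move=> GG' [N N0 hN]; exists N => // g /GG'; exact: hN. Qed.

Definition zmultiples e : set R := range (fun n : int => e *~ n).

Lemma zmultiples_gap e : 0 < e -> forall g h,
  zmultiples e g -> zmultiples e h -> g < h -> g + e <= h.
Proof.
move=> e0 _ _ [m _ <-] [n _ <-]; rewrite ltr_pMz2l // => mn.
by rewrite -[X in _ + X]mulr1z -mulrzDr ler_pMz2l // lezD1.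
Qed.

Lemma zmultiples_norm e : zmultiples `|e| = zmultiples e.
Proof.
have [e0|e0] := ger0P e => //; apply/seteqP; split=> _ [n _ <-].
  by exists (- n); rewrite // mulrNz mulNrz.
by exists (- n); rewrite // mulNrz mulrNz opprK.
Qed.

Lemma bounded_denominators_zmultiples G e : bounded_denominators G (zmultiples e) ->
  exists2 N, (0 < N)%N & G `<=` zmultiples (e / N%:R).
Proof.
move=> [N N0 hN]; exists N => // g /hN [n _ hn]; exists n => //.
have N0' : N%:R != 0 :> R by rewrite pnatr_eq0 -lt0n.
apply: (mulIf N0'); by rewrite [RHS]mulr_natr -hn -mulrzr -[RHS]mulrzr; field.
Qed.


(** A generator is the least positive multiple of [e] in [G]. *)
Lemma zmultiples_cyclic G e t : 0 < e -> 0 < t -> G t -> G `<=` zmultiples e ->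
  (forall g h, G g -> G h -> G (g - h)) -> exists2 d, 0 < d & G = zmultiples d.
Proof.
move=> e0 t0 Gt Ge Gsub.
have G0 : G 0 by rewrite -(subrr t); exact: Gsub.
have GM g (n : int) : G g -> G (g *~ n).
  move=> Gg; have Gn m : G (g *+ m).
    elim: m => [|m IH]; first by rewrite mulr0n.
    by rewrite mulrS -[X in _ + X]opprK -[X in - X]sub0r; apply: (Gsub _ _) => //; exact: Gsub.
  by case: n => m; [exact: Gn|rewrite NegzE mulrNz -sub0r; apply: (Gsub _ _) => //; exact: Gn].
have Gpos : exists n, (0 < n)%N && `[< G (e *+ n) >].
  have [n _ en] := Ge _ Gt; case: n en => n en.
    exists n; rewrite asboolT ?andbT; last by rewrite pmulrn en.
    by rewrite lt0n; apply: contraTneq t0 => n0; rewrite -en n0 ltxx.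
  by move: t0; rewrite -en NegzE mulrNz oppr_gt0 -pmulrn pmulrn_llt0 // ltNge ltW.
have [n /andP[n0 /asboolP Gn] nmin] := ex_minnP Gpos.
exists (e *+ n); first by rewrite pmulrn_lgt0.
apply/seteqP; split=> [g Gg|_ [m _ <-]]; last exact: GM.
have [m _ em] := Ge _ Gg; exists (m %/ n)%Z => //.
have nz : (n%:Z != 0)%R by rewrite eqz_nat -lt0n.
have gE : g = e *+ n *~ (m %/ n)%Z + e *+ `|(m %% n)%Z|%N.
  rewrite -em {1}(divz_eq m n) mulrzDr; congr (_ + _).
    by rewrite mulrC mulrzA -pmulrn.
  by rewrite -{1}(gez0_abs (modz_ge0 m nz)).
have Gr : G (e *+ `|(m %% n)%Z|%N).
  by rewrite (_ : _ *+ _ = g - e *+ n *~ (m %/ n)%Z); [apply: (Gsub _ _) => //; exact: GM|rewrite gE addrC addKr].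
rewrite gE; have [-> |r0] := posnP `|(m %% n)%Z|%N; first by rewrite mulr0n addr0.
have := nmin `|(m %% n)%Z|%N; rewrite r0 asboolT // => /(_ isT).
by rewrite -lez_nat gez0_abs ?modz_ge0 // leNgt; have := ltz_mod m nz; rewrite ger0_norm // => ->.
Qed.

(** Successive approximation: each correction raises the value of the error,
    and by discreteness it raises it by at least [e]. *)
Lemma approx_closure e (N W : set L) : 0 < e -> W `<=` N -> N 0 -> W 0 ->
  (forall x y, N x -> W y -> N (x - y)) ->
  (forall x y, W x -> W y -> W (x + y)) ->
  value_group v N `<=` zmultiples e ->
  (forall x, N x -> x != 0 -> exists2 y, W y & (v x < v (x - y)%R)%E) ->
  N `<=` clos W.
Proof.
move=> e0 WN N0 W0 NB WD hN step x Nx; have [a ha] := val_ge_ex v x.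
apply: (@closure_limit _ _ _ _ _ a e) => //; elim=> [|n [y Wy hy]].
  by exists 0; rewrite // mulr0n addr0 subr0.
have [xy0|xy0] := eqVneq (x - y) 0; first by exists y; rewrite // xy0 val_ge0.
have Nxy : N (x - y) by exact: NB.
have [z Wz hz] := step _ Nxy xy0; exists (y + z); first exact: WD.
rewrite opprD addrA; have [s vs] := val_finE v xy0.
have [xyz0|xyz0] := eqVneq (x - y - z) 0; first by rewrite xyz0 val_ge0.
have [t vt] := val_finE v xyz0.
have st : s + e <= t.
  apply: zmultiples_gap => //.
  - by apply: hN; exists (x - y).
  - by apply: hN; exists (x - y - z) => //; apply: NB.
  by move: hz; rewrite vs vt lte_fin.
apply: (val_ge_le _ (val_eq_ge vt)); move: hy; rewrite /val_ge vs lee_fin mulrSr.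
by lra.
Qed.

(** Among more multiples of [g] than there are cosets two lie in the same coset,
    hence a multiple of [g] by at most the index lies in [H]. *)
Lemma finite_index_bounded_denominators G H :
  (forall g n, G g -> G (g *+ n)) -> H 0 -> (forall g h, H g -> H h -> H (g - h)) ->
  subgroup_index G H <> None -> bounded_denominators G H.
Proof.
move=> GM H0 Hsub; rewrite /subgroup_index; set C := (X in finite_set X).
case: asboolP => // finC _; pose c g := [set g + h | h in H].
exists (#|` fset_set C|)`!; first exact: fact_gt0.
move=> g Gg; pose k := #|` fset_set C|.
pose F (i : 'I_k.+1) : set R := c (g *+ i).
have FC i : F i \in fset_set C.
  by rewrite in_fset_set // inE; exists (g *+ i) => //; exact: GM.
have : ~~ injectiveb F.
  apply/negP => /injectiveP injF.
  have : (#|` [fset F i | i in 'I_k.+1]%fset| <= k)%N.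
    by apply/fsubset_leq_card/fsubsetP => _ /imfsetP [i _ ->].
  by rewrite card_imfset //= -cardE card_ord ltnn.
move=> /injectivePn [i [j ij Fij]].
wlog lt_ij : i j ij Fij / (i < j)%N.
  move=> hw; move: (ij); rewrite neq_ltn => /orP[lt_ij|lt_ji]; first exact: (hw i j).
  by apply: (hw j i) => //; rewrite eq_sym.
have Hg : H (g *+ (j - i)).
  have : F j (g *+ j) by exists 0; rewrite ?addr0.
  rewrite -Fij => -[h Hh hj].
  by rewrite mulrnBr 1?ltnW // -hj addrC addKr.
have dvd : (j - i %| k`!)%N.
  by rewrite dvdn_fact // subn_gt0 lt_ij /= (leq_trans (leq_subr _ _)) // -ltnS.
rewrite -(divnK dvd) mulnC mulrnA; elim: (_ %/ _)%N => [|n IH]; first by rewrite mulr0n.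
rewrite mulrS -[X in _ + X]opprK -[X in - X]sub0r; apply: (Hsub _ _) => //; exact: Hsub.
Qed.

Lemma zmultiples_finite_index G e : bounded_denominators G (zmultiples e) ->
  subgroup_index G (zmultiples e) <> None.
Proof.
move=> /bounded_denominators_zmultiples [N N0 hG]; rewrite /subgroup_index.
case: asboolP => //; case.
pose c g := [set g + h | h in zmultiples e].
apply: (@sub_finite_set _ _ [set c (e / N%:R *+ i) | i in `I_N]).
  move=> _ [g /hG [n _ <-] <-].
  have N0' : N%:R != 0 :> R by rewrite pnatr_eq0 -lt0n.
  have Nz : (N%:Z != 0)%R by rewrite eqz_nat -lt0n.
  exists `|(n %% N)%Z|%N.
    rewrite /= -ltz_nat gez0_abs ?modz_ge0 //.
    by have := ltz_mod n Nz; rewrite ger0_norm.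
  have -> : e / N%:R *~ n = e / N%:R *+ `|(n %% N)%Z|%N + e *~ (n %/ N)%Z.
    rewrite {1}(divz_eq n N) mulrzDr addrC; congr (_ + _).
      by rewrite -{1}(gez0_abs (modz_ge0 n Nz)).
    rewrite -mulrzr intrM -mulrzr; field.
    by [].
  apply/seteqP; split=> _ [_ [m _ <-] <-].
    exists (e *~ (m - (n %/ N)%Z)); first by exists (m - (n %/ N)%Z).
    by rewrite mulrzBr; ring.
  exists (e *~ (m + (n %/ N)%Z)); first by exists (m + (n %/ N)%Z).
  by rewrite mulrzDr; ring.
exact/finite_image/finite_II.
Qed.

End ValueGroups.

(** * Newton iteration *)

Section Newton.
Context {R : realType} {L : fieldType} (v : valuation R L).
Implicit Types (E : set L) (x y : L) (p : {poly L}).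
Local Notation clos := (valuation_closure v).

(** A lower bound for the Gauss valuation of [p] on the ball of radius [r]. *)
Definition poly_val_ge (r A : R) p := forall i, val_ge v (A - r *+ i) p`_i.

Lemma poly_val_ge_ex r p : exists A, poly_val_ge r A p.
Proof.
elim/poly_ind: p => [|p c [A hA]].
  by exists 0 => i; rewrite coef0 val_ge0.
have [a ha] := val_ge_ex v c; exists (Num.min (A + r) a) => -[|i].
  rewrite coefD coefMX coefC /= add0r mulr0n subr0; apply: val_ge_le ha.
  by rewrite ge_min lexx orbT.
rewrite coefD coefMX coefC /= addr0; apply: val_ge_le (hA i).
by rewrite mulrS opprD addrA lerD2r lerBlDr ge_min lexx.
Qed.

Lemma poly_val_ge_deriv r A p : poly_val_ge r A p -> poly_val_ge r (A - r) p^`().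
Proof.
move=> hp i; rewrite coef_deriv; have := hp i.+1.
rewrite mulrS opprD addrA; move: p`_i.+1 => c h; elim: (i.+1) => [|n IH]; first by rewrite mulr0n val_ge0.
by rewrite mulrS; apply: val_geD.
Qed.

(** The first two Taylor remainders of [p], by induction on [p]; the shifts by [r]
    come from dividing out one, respectively two, factors of size [r]. *)
Lemma poly_val_taylor r A p y z d : poly_val_ge r A p ->
  val_ge v r y -> val_ge v r z -> val_ge v d (y - z) ->
  [/\ val_ge v A p.[y], val_ge v (d + A - r) (p.[y] - p.[z]) &
      val_ge v (d + d + A - r - r) (p.[y] - p.[z] - p^`().[z] * (y - z))].
Proof.
move=> + ry rz dyz; elim/poly_ind: p A => [|p c IH] A hp.
  by rewrite deriv0 !horner0 mul0r !subr0; split; exact: val_ge0.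
have hp' : poly_val_ge r (A - r) p.
  move=> i; have := hp i.+1; rewrite coefD coefMX coefC /= addr0 mulrS.
  by rewrite opprD addrA.
have hc : val_ge v A c.
  by have := hp 0%N; rewrite coefD coefMX coefC /= add0r mulr0n subr0.
have [h1 h2 h3] := IH _ hp'; rewrite derivMXaddC !hornerE.
split.
- by apply: val_geD => //; rewrite -[A](subrK r); exact: val_geM.
- have -> : p.[y] * y + c - (p.[z] * z + c) = p.[y] * (y - z) + (p.[y] - p.[z]) * z by ring.
  apply: val_geD; first by rewrite -addrA addrC; exact: val_geM.
  by apply: (val_ge_le _ (val_geM h2 rz)); lra.
have -> : p.[y] * y + c - (p.[z] * z + c) - (p.[z] + p^`().[z] * z) * (y - z) =
  (p.[y] - p.[z] - p^`().[z] * (y - z)) * z + (p.[y] - p.[z]) * (y - z) by ring.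
apply: val_geD; first by apply: (val_ge_le _ (val_geM h3 rz)); lra.
by apply: (val_ge_le _ (val_geM h2 dyz)); lra.
Qed.

(** The error after the step is the slope error times the distance plus the
    second Taylor remainder, both divided by [s]. *)
Lemma newton_step r A p x y d e s t : poly_val_ge r A p -> root p x ->
  val_ge v r x -> val_ge v r y -> val_ge v d (y - x) ->
  v s = t%:E -> val_ge v (t + e) (s - p^`().[x]) -> t + e <= d + A - r - r ->
  val_ge v (d + e) (y - p.[y] / s - x).
Proof.
move=> hp /eqP px rx ry hd vs hs hte; have s0 := val_finP vs.
have [_ _ h3] := poly_val_taylor hp ry rx hd.
have -> : y - p.[y] / s - x = ((s - p^`().[x]) * (y - x) -
    (p.[y] - p.[x] - p^`().[x] * (y - x))) * s^-1.
  by rewrite px; field.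
rewrite (_ : d + e = d + e + t - t); last by rewrite addrK.
apply: val_geM; last exact/val_eq_ge/val_eqV.
apply: val_geB; first by apply: (val_ge_le _ (val_geM hs hd)); lra.
by apply: (val_ge_le _ h3); lra.
Qed.

(** Newton iteration started in a closed subfield stays in it and converges to
    the root. *)
Lemma newton_root_mem E r A p x b d e s t :
  subfield E -> clos E `<=` E -> (forall i, E p`_i) -> poly_val_ge r A p ->
  root p x -> val_ge v r x -> E b -> val_ge v d (b - x) -> r <= d ->
  E s -> v s = t%:E -> val_ge v (t + e) (s - p^`().[x]) -> 0 < e ->
  t + e <= d + A - r - r -> E x.
Proof.
move=> hE cE Ep hp px rx Eb db rd Es vs hs e0 hte; apply: cE.
apply: (@closure_limit _ _ _ _ _ d e) => // n.
suff [y Ey hy] : exists2 y, E y & val_ge v (d + e *+ n) (y - x).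
  by exists y; rewrite // val_geBC.
elim: n => [|n [y Ey hy]]; first by exists b; rewrite // mulr0n addr0.
have en : 0 <= e *+ n by rewrite mulrn_wge0 ?ltW.
have ry : val_ge v r y.
  rewrite -(subrK x y); apply: val_geD => //; apply: val_ge_le hy; lra.
exists (y - p.[y] / s).
  by apply: subfieldB => //; apply: subfield_div => //; exact: subfield_horner.
rewrite mulrSr addrA; apply: (newton_step hp px rx ry hy vs hs).
by lra.
Qed.

(** This plays the role of Krasner's lemma: the required closeness [d] depends
    only on [p] and [x], so [E] may be chosen after it. *)
Lemma simple_root_mem p x : root p x -> p^`().[x] != 0 ->
  exists d, forall E b, subfield E -> clos E `<=` E -> (forall i, E p`_i) ->
    E b -> val_ge v d (b - x) -> E x.
Proof.
move=> px p'x; have [r rx] := val_ge_ex v x; have [t vt] := val_finE v p'x.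
have [A hA] := poly_val_ge_ex r p.
exists (Num.max r (t + 1 - A + r + r)) => E b hE cE Ep Eb; set d := Num.max _ _ => db.
have rd : r <= d by rewrite le_max lexx.
have td : t + 1 - A + r + r <= d by rewrite le_max lexx orbT.
have rb : val_ge v r b.
  by rewrite -(subrK x b); apply: val_geD => //; exact: val_ge_le rd db.
have Ep' i : E p^`()`_i.
  rewrite coef_deriv; have := Ep i.+1; move: p`_i.+1 => c Ec; elim: (i.+1) => [|n IH]; first by rewrite mulr0n; exact: subfield0.
  by rewrite mulrS; exact: subfieldD.
have [_ h2 _] := poly_val_taylor (poly_val_ge_deriv hA) rb rx db.
have h2' : val_ge v (t + 1) (p^`().[b] - p^`().[x]) by apply: val_ge_le h2; lra.
apply: (@newton_root_mem E r A p x b d 1 p^`().[b] t) => //.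
- exact: subfield_horner.
- by apply: (val_eq_near_ge vt (s := t + 1)); [lra|rewrite val_geBC].
- by lra.
Qed.

Definition integral_coefs p := forall i, val_ge v 0 p`_i.

Lemma integral_poly_val_ge p : integral_coefs p <-> poly_val_ge 0 0 p.
Proof. by split=> h i; have := h i; rewrite mul0rn subr0. Qed.

Lemma integral_taylor p y z d : integral_coefs p ->
  val_ge v 0 y -> val_ge v 0 z -> val_ge v d (y - z) ->
  [/\ val_ge v 0 p.[y], val_ge v d (p.[y] - p.[z]) &
      val_ge v (d + d) (p.[y] - p.[z] - p^`().[z] * (y - z))].
Proof.
move=> /integral_poly_val_ge hp hy hz hd.
by have := poly_val_taylor hp hy hz hd; rewrite !subr0 !addr0.
Qed.

Lemma integral_coefs_deriv p : integral_coefs p -> integral_coefs p^`().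
Proof.
by move=> /integral_poly_val_ge/poly_val_ge_deriv; rewrite subr0 => /integral_poly_val_ge.
Qed.

Lemma integral_simple_root_mem E p x b e :
  subfield E -> clos E `<=` E -> (forall i, E p`_i) -> integral_coefs p ->
  root p x -> val_ge v 0 x -> v p^`().[x] = 0%:E -> E b -> 0 < e ->
  val_ge v e (b - x) -> E x.
Proof.
move=> hE cE Ep hp px ix vx Eb e0 hb.
have ib : val_ge v 0 b.
  by rewrite -(subrK x b); apply: val_geD => //; apply: val_ge_le hb; exact: ltW.
have Ep' i : E p^`()`_i.
  rewrite coef_deriv; have := Ep i.+1; move: p`_i.+1 => c Ec; elim: (i.+1) => [|n IH]; first by rewrite mulr0n; exact: subfield0.
  by rewrite mulrS; exact: subfieldD.
have [_ h2 _] := integral_taylor (integral_coefs_deriv hp) ib ix hb.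
apply: (@newton_root_mem E 0 0 p x b e e p^`().[b] 0) => //.
- exact/integral_poly_val_ge.
- exact: ltW.
- exact: subfield_horner.
- by apply: (val_eq_near_ge vx e0); rewrite val_geBC.
- by rewrite add0r.
- by lra.
Qed.

Hypothesis v_complete : valuation_complete v.

(** Hensel's lemma, with the derivative at [a] as fixed slope of the iteration. *)
Lemma hensel_root p a e : integral_coefs p -> val_ge v 0 a -> 0 < e ->
  val_ge v e p.[a] -> v p^`().[a] = 0%:E ->
  exists2 b, root p b & val_ge v e (b - a).
Proof.
move=> hp ia e0 pa p'a; set s := p^`().[a] in p'a *.
have s0 := val_finP p'a; have vs := val_eqV p'a; rewrite oppr0 in vs.
pose u n := iter n (fun y => y - p.[y] / s) a.
have en n : 0 <= e *+ n by rewrite mulrn_wge0 ?ltW.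
have hu n : val_ge v e (u n - a) /\ val_ge v (e + e *+ n) p.[u n].
  elim: n => [|n [h1 h2]]; first by rewrite subrr mulr0n addr0; split=> //; exact: val_ge0.
  have iu : val_ge v 0 (u n).
    by rewrite -(subrK a (u n)); apply: val_geD => //; apply: val_ge_le h1; exact: ltW.
  have hq : val_ge v (e + e *+ n) (p.[u n] / s).
    by rewrite -[_ + _]addr0; apply: val_geM => //; exact: val_eq_ge.
  have hq' : val_ge v (e + e *+ n) (u n.+1 - u n) by rewrite /= addrAC subrr sub0r val_geN.
  have iu' : val_ge v 0 (u n.+1).
    rewrite -(subrK (u n) (u n.+1)); apply: val_geD => //; apply: val_ge_le hq'.
    by have := en n; lra.
  split.
    rewrite /= addrAC; apply: val_geB => //; apply: val_ge_le hq.
    by have := en n; lra.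
  have [_ _ h3] := integral_taylor hp iu' iu hq'.
  have [_ h4 _] := integral_taylor (integral_coefs_deriv hp) iu ia h1.
  have -> : p.[u n.+1] = (p.[u n.+1] - p.[u n] - p^`().[u n] * (u n.+1 - u n))
      - (p^`().[u n] - s) * (p.[u n] / s).
    by rewrite /=; set q := p.[_ - _]; field.
  rewrite mulrSr addrA; have := en n; move=> en0; apply: val_geB.
    by apply: val_ge_le h3; lra.
  by rewrite addrC; apply: val_geM.
have step n : val_ge v (e + e *+ n) (u n - u n.+1).
  rewrite /= opprB addrCA subrr addr0 -[_ + _]addr0.
  by apply: val_geM; [exact: (hu n).2|exact: val_eq_ge].
have cauchy n m : (n <= m)%N -> val_ge v (e + e *+ n) (u n - u m).
  move=> /subnKC <-; elim: (m - n)%N => [|k IH]; first by rewrite addn0 subrr val_ge0.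
  apply: val_ge_trans IH _; rewrite addnS; apply: val_ge_le (step _).
  by rewrite lerD2l ler_wpMn2l ?leq_addr // ltW.
have [b hb] := cauchy_limit v_complete e0 cauchy.
have ib : val_ge v e (b - a).
  by have := hb 0%N; rewrite /= mulr0n addr0 val_geBC.
have ib0 : val_ge v 0 b.
  by rewrite -(subrK a b); apply: val_geD => //; apply: val_ge_le ib; exact: ltW.
exists b => //; apply/eqP/(val_ge_eq0 (v := v)) => r.
have [n hn] := ler_linear e r e0; apply: (val_ge_le hn).
have iu : val_ge v 0 (u n).
  by rewrite -(subrK a (u n)); apply: val_geD => //; apply: val_ge_le (hu n).1; exact: ltW.
have hbn : val_ge v (e + e *+ n) (b - u n) by rewrite val_geBC.
have [_ h _] := integral_taylor hp ib0 iu hbn.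
by rewrite -(subrK p.[u n] p.[b]); apply: val_geD => //; exact: (hu n).2.
Qed.

End Newton.

(** * Étale elements *)

Section Etale.
Context {R : realType} {L : fieldType} (v : valuation R L).
Hypothesis v_complete : valuation_complete v.
Implicit Types (A E : set L) (x y : L).
Local Notation clos := (valuation_closure v).

Definition etale A x := val_ge v 0 x /\
  exists p, [/\ p \is monic, forall i, A p`_i, integral_coefs v p, root p x &
    v p^`().[x] = 0%:E].

Lemma integral_coefsD p q : integral_coefs v p -> integral_coefs v q -> integral_coefs v (p + q).
Proof. by move=> hp hq i; rewrite coefD; apply: val_geD. Qed.

Lemma integral_coefsM p q : integral_coefs v p -> integral_coefs v q -> integral_coefs v (p * q).
Proof.
move=> hp hq i; rewrite coefM; apply: val_ge_sum => j _.
by apply: val_ge0M.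
Qed.

Lemma integral_polyCX c n : val_ge v 0 c -> integral_coefs v (c *: 'X^n).
Proof.
move=> hc i; rewrite coefZ coefXn; case: eqP => _; rewrite ?mulr1 //.
by rewrite mulr0 val_ge0.
Qed.

Section ResidueMinimal.
Variables (F : fieldType) (f : {rmorphism F -> L}).
Local Notation "p ^f" := (map_poly f p) : ring_scope.
Implicit Types p q h : {poly F}.

Lemma size_top_cancel p c n : size p = n.+1 -> lead_coef p = c ->
  (size (p - c *: 'X^n)%R <= n)%N.
Proof.
move=> sp lp; apply/leq_sizeP => i ni; rewrite coefB coefZ coefXn.
have [->|ni'] := eqVneq i n; first by rewrite -lp lead_coefE sp mulr1 subrr.
by rewrite mulr0 subr0 nth_default // sp ltn_neqAle eq_sym ni' ni.
Qed.

Lemma integral_divp h p : h \is monic -> integral_coefs v h^f -> integral_coefs v p^f ->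
  exists q r, [/\ integral_coefs v q^f, integral_coefs v r^f, (size r < size h)%N &
    p = q * h + r].
Proof.
move=> mh ih; elim: (size p) {-2}p (leqnn (size p)) => [|n IH] {}p sp ip.
  move: sp; rewrite leqn0 size_poly_eq0 => /eqP p0; exists 0, 0.
  rewrite p0 rmorph0 mul0r addr0 size_poly0 size_poly_gt0 monic_neq0 //.
  by split=> // i; rewrite coef0 val_ge0.
have [sph|] := ltnP (size p) (size h).
  exists 0, p; rewrite mul0r add0r rmorph0; split=> // i.
  by rewrite coef0 val_ge0.
move=> shp; have [spn|spn] := eqVneq (size p) n.+1; last first.
  by apply: IH ip; rewrite -ltnS ltn_neqAle spn sp.
have sh : (0 < size h)%N by rewrite size_poly_gt0 monic_neq0.
pose c := lead_coef p; pose m := (size p - size h)%N.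
have ic : val_ge v 0 (f c) by have := ip (size p).-1; rewrite coef_map.
have [||q [r [iq ir sr pqr]]] := IH (p - c *: 'X^m * h).
- apply/leq_sizeP => i ni; rewrite coefB -scalerAl coefZ coefXnM.
  have -> : (i < m)%N = false by apply/negbTE; rewrite -leqNgt (leq_trans _ ni) // /m spn leq_subLR -add1n leq_add2r.
  have [->|ni'] := eqVneq i n.
    have -> : (n - m = (size h).-1)%N by rewrite /m spn; case: (size h) sh shp spn => // k _; rewrite subSS => kp pn; rewrite subKn // -ltnS -pn.
    by rewrite -lead_coefE (monicP mh) mulr1 /c lead_coefE spn subrr.
  have ni2 : (n < i)%N by rewrite ltn_neqAle eq_sym ni' ni.
  rewrite (nth_default 0 (s := p)) ?spn // (nth_default 0 (s := h)) ?mulr0 ?subr0 //.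
  by rewrite /m spn; move: shp ni2; rewrite spn; move: (size h) => a; clear; lia.
- rewrite rmorphB rmorphM /= map_polyZ map_polyXn; apply: integral_coefsD => //.
  rewrite -mulNr -scaleNr; apply: integral_coefsM => //; apply: integral_polyCX.
  by rewrite val_geN.
exists (c *: 'X^m + q), r; split=> //.
  rewrite rmorphD /= map_polyZ map_polyXn; apply: integral_coefsD => //.
  exact: integral_polyCX.
by rewrite mulrDl -addrA -pqr addrC subrK.
Qed.

(** [h] lifts the minimal polynomial of the residue of [a]. *)
Definition residue_minimal h a :=
  [/\ h \is monic, integral_coefs v h^f, (0%E < v (h^f).[a])%E &
      forall q, q \is monic -> integral_coefs v q^f -> (0%E < v (q^f).[a])%E ->
        (size h <= size q)%N].

Lemma residue_minimal_exists p a : p \is monic -> integral_coefs v p^f ->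
  (0%E < v (p^f).[a])%E -> exists h, residue_minimal h a.
Proof.
move=> mp ip vp.
pose P n := `[< exists q, [/\ q \is monic, integral_coefs v q^f, (0%E < v (q^f).[a])%E & size q = n] >].
have exP : exists n, P n by exists (size p); apply/asboolP; exists p.
have [m /asboolP [h [mh ih vh <-]] hmin] := ex_minnP exP.
exists h; split=> // q mq iq vq; apply: hmin; apply/asboolP; by exists q.
Qed.

(** Over the residue field, a polynomial vanishing at the residue of [a] and of
    degree less than the minimal polynomial is 0: otherwise truncate it at its
    last unit coefficient and make it monic. *)
Lemma residue_minimal_coef h a q : residue_minimal h a -> val_ge v 0 a ->
  integral_coefs v q^f -> (size q < size h)%N -> (0%E < v (q^f).[a])%E ->
  forall i, (0%E < v (f q`_i))%E.
Proof.
move=> [mh ih vh hmin] ia.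
elim: (size q) {-2}q (leqnn (size q)) => [|n IH] {}q sq iq sqh vq i.
  move: sq; rewrite leqn0 size_poly_eq0 => /eqP ->.
  by rewrite coef0 raddf0 val0 ltry.
have [spn|spn] := eqVneq (size q) n.+1; last first.
  by apply: IH => //; rewrite -ltnS ltn_neqAle spn sq.
pose c := lead_coef q.
have ic : val_ge v 0 (f c) by have := iq (size q).-1; rewrite coef_map.
have c0 : c != 0 by rewrite lead_coef_eq0 -size_poly_gt0 spn.
case: (boolP (0%E < v (f c))%E) => [vc|/(val_unit ic) vc]; last first.
  have vc' : v (f c^-1) = 0%:E by rewrite fmorphV; have := val_eqV vc; rewrite oppr0.
  have iq' : integral_coefs v (c^-1 *: q)^f.
    move=> k; rewrite coef_map /= coefZ rmorphM; apply: val_ge0M; first exact: val_eq_ge.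
    by have := iq k; rewrite coef_map.
  suff : (size h <= size (c^-1 *: q))%N by rewrite size_scale ?invr_eq0 // leqNgt sqh.
  apply: hmin => //; first by rewrite monicE lead_coefZ mulVf.
  by rewrite map_polyZ hornerZ; apply: val_gt0M => //; exact: val_eq_ge.
pose q1 := q - c *: 'X^n.
have iq1 : integral_coefs v q1^f.
  rewrite rmorphB /= map_polyZ map_polyXn; apply: integral_coefsD => //.
  by rewrite -scaleNr; apply: integral_polyCX; rewrite val_geN.
have := IH q1 (size_top_cancel spn erefl) iq1.
have -> : q`_i = q1`_i + (c *: 'X^n)`_i by rewrite -coefD subrK.
move=> h1; rewrite raddfD; apply: val_gt0D.
  apply: h1; first by apply: leq_ltn_trans (size_top_cancel spn erefl) _; rewrite -spn ltnW.
  rewrite rmorphB /= map_polyZ map_polyXn hornerD hornerN hornerZ hornerXn.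
  apply: val_gt0D => //; rewrite -mulNr mulrC; apply: val_gt0M; first exact: val_ge0X.
  by rewrite valN.
rewrite coefZ coefXn; case: eqP => _; rewrite ?mulr1 // mulr0 raddf0 val0.
exact: ltry.
Qed.

(** Modulo the maximal ideal, [h] divides [p], and the residue of [a] is a simple
    root of [p], hence of [h]. *)
Lemma residue_minimal_deriv h a p : residue_minimal h a -> val_ge v 0 a ->
  integral_coefs v p^f -> root p^f a -> v (p^f)^`().[a] = 0%:E ->
  v (h^f)^`().[a] = 0%:E.
Proof.
move=> hm ia ip pa vp; have [mh ih vh hmin] := hm.
have [q [r [iq ir sr pE]]] := integral_divp mh ih ip.
have hval s : integral_coefs v s -> val_ge v 0 s.[a].
  move=> is_; rewrite horner_coef; apply: val_ge_sum => k _.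
  by apply: val_ge0M => //; exact: val_ge0X.
have hgt (s : {poly L}) : (forall i, (0%E < v (s`_i))%E) -> (0%E < v (s.[a]))%E.
  move=> is_; rewrite horner_coef; elim/big_ind: _ => [|x y|k _]; first by rewrite val0 ltry.
    exact: val_gt0D.
  by rewrite mulrC; apply: val_gt0M => //; exact: val_ge0X.
have vr : (0%E < v (r^f).[a])%E.
  have -> : (r^f).[a] = - (q^f).[a] * (h^f).[a].
    move: pa; rewrite pE rmorphD rmorphM /= /root hornerD hornerM addrC addr_eq0.
    by rewrite mulNr => /eqP.
  by apply: val_gt0M => //; rewrite val_geN; exact: hval.
have rpos := residue_minimal_coef hm ia ir sr vr.
have r'pos : (0%E < v (r^f)^`().[a])%E.
  apply: hgt => i; rewrite coef_deriv coef_map /=; move: (rpos i.+1) => ri; move: (f _) ri => c ri; elim: i => [|n IH]; first by rewrite mulr1n.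
  by rewrite mulrS; apply: val_gt0D.
apply: val_unit; first exact/hval/integral_coefs_deriv.
apply/negP => h'pos; suff : (0%E < v (p^f)^`().[a])%E by rewrite vp ltxx.
rewrite pE rmorphD rmorphM /= derivD derivM !hornerE; apply: val_gt0D => //.
apply: val_gt0D; apply: val_gt0M => //; apply: hval => //.
exact: integral_coefs_deriv.
Qed.

(** Being [residue_minimal] depends only on the residue of [a]. *)
Lemma residue_minimal_near h a b e : residue_minimal h a -> val_ge v 0 a ->
  0 < e -> val_ge v e (b - a) -> residue_minimal h b.
Proof.
move=> [mh ih vh hmin] ia e0 hb.
have ib : val_ge v 0 b.
  by rewrite -(subrK a b); apply: val_geD => //; apply: val_ge_le hb; exact: ltW.
split=> // [|q mq iq vq]; last apply: hmin => //.
  have [_ h2 _] := integral_taylor ih ib ia hb.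
  by rewrite -(subrK (h^f).[a] (h^f).[b]); apply: val_gt0D => //; exact: val_ge_gt h2.
have [_ h2 _] := integral_taylor iq ib ia hb.
rewrite -(subrK (q^f).[b] (q^f).[a]); apply: val_gt0D => //.
by apply: (val_ge_gt e0); rewrite val_geBC.
Qed.

(** The powers of [b] below the degree of [h] stay independent over the residue
    field, so the valuation is the minimum over the coefficients. *)
Lemma residue_minimal_val h b q : residue_minimal h b -> val_ge v 0 b ->
  q != 0 -> (size q < size h)%N -> exists2 c, c != 0 & v (q^f).[b] = v (f c).
Proof.
move=> hm ib q0 sq; have sq0 : (0 < size q)%N by rewrite size_poly_gt0.
pose i0 := Ordinal (etrans (ltn_predL _) sq0).
have qi0 : q`_i0 != 0 by rewrite /= -lead_coefE lead_coef_eq0.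
case: (@arg_minP _ _ _ i0 (fun i : 'I_(size q) => q`_i != 0) (fun i => v (f q`_i)) qi0).
move=> i qi hmin; exists q`_i => //; set c := q`_i in qi hmin *.
have [t vc] : exists t, v (f c) = t%:E by apply: val_finE; rewrite fmorph_eq0.
pose q' := c^-1 *: q.
have iq' : integral_coefs v q'^f.
  move=> k; rewrite coef_map /= coefZ rmorphM fmorphV /=.
  have [->|qk] := eqVneq q`_k 0; first by rewrite raddf0 mulr0 val_ge0.
  have sk : (k < size q)%N by rewrite ltnNge; apply: contra qk => /(nth_default 0) ->.
  rewrite -[0](addNr t); apply: val_geM; first exact/val_eq_ge/val_eqV.
  by rewrite /val_ge -vc; exact: (hmin (Ordinal sk)).
have vq' : v (q'^f).[b] = 0%:E.
  apply: val_unit.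
    rewrite horner_coef; apply: val_ge_sum => k _.
    by apply: val_ge0M => //; exact: val_ge0X.
  have sq' : (size q' < size h)%N by rewrite size_scale ?invr_eq0.
  apply/negP => /(residue_minimal_coef hm ib iq' sq')/(_ i).
  by rewrite coefZ mulVf // rmorph1 val1 ltxx.
have -> : (q^f).[b] = f c * (q'^f).[b].
  by rewrite map_polyZ hornerZ fmorphV mulVKf // fmorph_eq0.
by rewrite Defs.valM vq' adde0.
Qed.

End ResidueMinimal.

(** Let [h] lift the minimal polynomial of the residue of [a]. By Hensel's lemma
    [h] has a root [b] near [a]; the field [E(b)] has the degree of [h], so its
    residue degree accounts for its whole degree and it has no new values.
    Newton iteration from [b] then shows that it contains [a]. *)
Lemma etale_extension A E a : A `<=` E -> subfield E -> clos E `<=` E ->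
  etale A a -> exists E', [/\ finite_extension E E', clos E' `<=` E',
    E' a & value_group v E' = value_group v E].
Proof.
move=> AE hE cE [ia [p [mp Ap ip pa vp]]].
have [F [f fE]] := subfield_as_range hE.
have [p0 p0E] : exists p0, map_poly f p0 = p.
  by apply: map_poly_range => i; rewrite fE; exact: AE.
rewrite -p0E in mp ip pa vp.
have [h hm] : exists h, residue_minimal f h a.
  apply: (residue_minimal_exists (p := p0)) => //; first by rewrite map_monic in mp.
  by rewrite (eqP pa) val0 ltry.
have h'a := residue_minimal_deriv hm ia ip pa vp.
have [mh ih vh _] := hm; have [e e0 hae] := val_gt_ge vh.
have [b hb ba] := hensel_root v_complete ih ia e0 hae h'a.
have hmb := residue_minimal_near hm ia e0 ba.
have ib : val_ge v 0 b.
  by rewrite -(subrK a b); apply: val_geD => //; apply: val_ge_le ba; exact: ltW.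
have [finE' E'b E'small] := simple_extension (monic_neq0 mh) hb.
rewrite fE in finE'; have [sE' EE' _] := finE'.
have cE' := finite_extension_closed v_complete cE hE finE'.
eexists; split; first exact: finE'.
- exact: cE'.
- apply: (integral_simple_root_mem sE' cE' _ ip pa ia vp E'b e0 ba) => i.
  by rewrite p0E; apply: EE'; apply: AE.
apply/seteqP; split; last exact: value_group_subset.
move=> g [y /E'small [q sq ->] vy].
have q0 : q != 0 by apply: contraTneq (val_finP vy) => ->; rewrite rmorph0 horner0 eqxx.
have [c c0 vc] := residue_minimal_val hmb ib q0 sq.
exists (f c); last by rewrite -vc.
by rewrite -fE; exists c.
Qed.

Definition etale_hull A E : set L := generated_subfield (E `|` etale A).

Lemma etale_extension_seq A E (s : seq L) : A `<=` E -> subfield E -> clos E `<=` E ->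
  (forall a, a \in s -> etale A a) -> exists E', [/\ subfield E', E `<=` E',
    clos E' `<=` E', (forall a, a \in s -> E' a) &
    value_group v E' = value_group v E].
Proof.
move=> AE hE cE; elim: s => [|a s IH] hs; first by exists E; split.
have [|E1 [hE1 EE1 cE1 sE1 vE1]] := IH.
  by move=> b bs; apply: hs; rewrite inE bs orbT.
have [|E2 [[hE2 E12 _] cE2 E2a vE2]] := etale_extension (subset_trans AE EE1) hE1 cE1 (a := a).
  by apply: hs; rewrite inE eqxx.
exists E2; split=> //; first exact: subset_trans E12.
  by move=> b; rewrite inE => /predU1P[->//|bs]; apply: E12; exact: sE1.
by rewrite vE2.
Qed.

Lemma etale_hullP A E : subfield (etale_hull A E).
Proof. exact: generated_subfieldP. Qed.

Lemma sub_etale_hull A E : E `<=` etale_hull A E.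
Proof. by move=> x hx; apply: sub_generated_subfield; left. Qed.

Lemma etale_sub_hull A E : etale A `<=` etale_hull A E.
Proof. by move=> x hx; apply: sub_generated_subfield; right. Qed.

Lemma etale_hull_subset A E F : E `<=` F -> etale_hull A E `<=` etale_hull A F.
Proof.
move=> EF; apply: generated_subfield_sub; first exact: etale_hullP.
by move=> x [/EF|]; [exact: sub_etale_hull|exact: etale_sub_hull].
Qed.

(** An element of the hull involves finitely many étale elements only. *)
Lemma value_group_etale_hull A E : A `<=` E -> subfield E -> clos E `<=` E ->
  value_group v (etale_hull A E) = value_group v E.
Proof.
move=> AE hE cE; apply/seteqP; split; last by apply: value_group_subset; exact: sub_etale_hull.
(* [U] collects what lies in every field containing [E] and a finite set of
   étale elements *)
pose U := [set x : L | exists s : seq L, (forall a, a \in s -> etale A a) /\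
  forall E', subfield E' -> E `<=` E' -> (forall a, a \in s -> E' a) -> E' x].
have hU : subfield U.
  apply: subfield_intro => [|x y [s [hs sx]] [t [ht ty]]|x y [s [hs sx]] [t [ht ty]] _].
  - by exists [::]; split=> // E' hE' _ _; exact: subfield1.
  - exists (s ++ t); split=> [a|E' hE' EE' hE'a].
      by rewrite mem_cat => /orP[/hs|/ht].
    apply: subfieldB => //; [apply: sx|apply: ty] => // a ha; apply: hE'a;
      by rewrite mem_cat ha ?orbT.
  exists (s ++ t); split=> [a|E' hE' EE' hE'a].
    by rewrite mem_cat => /orP[/hs|/ht].
  apply: subfield_div => //; [apply: sx|apply: ty] => // a ha; apply: hE'a;
    by rewrite mem_cat ha ?orbT.
have subU : etale_hull A E `<=` U.
  apply: generated_subfield_sub => // x [Ex|ex].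
    by exists [::]; split=> // E' _ EE' _; exact: EE'.
  exists [:: x]; split=> [a|E' _ _]; first by rewrite inE => /eqP ->.
  by apply; rewrite inE eqxx.
move=> g [x /subU [s [hs sx]] vx].
have [E' [hE' EE' _ sE' <-]] := etale_extension_seq AE hE cE hs.
by exists x => //; exact: sx.
Qed.

End Etale.

(** * Elements of finite ramification *)

Section BoundedRamification.
Context {R : realType} {C : fieldType} (v : valuation R C).
Hypothesis v_complete : valuation_complete v.
Implicit Types (E F : set C) (x y : C).
Local Notation clos := (valuation_closure v).

Variables (A : set C) (e : R).
Hypotheses (subA : subfield A) (closA : clos A `<=` A) (e_gt0 : 0 < e)
  (valA : value_group v A = zmultiples e).

Hypothesis etale_residue : forall u, v u = 0%E ->
  exists2 a, etale v A a & (0%E < v (u - a)%R)%E.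

Local Notation hull F := (etale_hull v A F).

Lemma closed_hull_subfield F : subfield (clos (hull F)).
Proof. by apply: closure_subfield; exact: etale_hullP. Qed.

(** The leading digit of [y], with [c] as unit of measurement. *)
Lemma etale_approx c y : y != 0 -> v c = v y ->
  exists2 a, etale v A a & (v y < v (y - a * c)%R)%E.
Proof.
move=> y0 cy; have [t vy] := val_finE v y0; have vc : v c = t%:E by rewrite cy.
have c0 := val_finP vc.
have [|a ea ha] := etale_residue (u := y / c).
  by rewrite (val_eqM vy (val_eqV vc)) subrr.
exists a => //; have -> : y - a * c = c * (y / c - a) by field.
have [s s0 hs] := val_gt_ge ha; rewrite vy; apply: (@val_ge_gt _ _ _ _ (t + s)).
  by rewrite ltrDl.
by apply: val_geM => //; exact: val_eq_ge.
Qed.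

Lemma finite_extension_facts F : finite_extension A F ->
  [/\ subfield F, A `<=` F, clos F `<=` F,
      bounded_denominators (value_group v F) (zmultiples e) &
      value_group v (clos (hull F)) = value_group v F].
Proof.
move=> finF; have [hF AF _] := finF.
have cF := finite_extension_closed v_complete closA subA finF.
split=> //; first by rewrite -valA; exact: value_group_finite_extension.
by rewrite value_group_closure value_group_etale_hull.
Qed.

(** The hull of [E] still has the values of [F]; so every nonzero element of it
    has the value of some [c] in [F], and its leading digit lies in the hull
    of [F]. *)
Lemma unramified_sub_hull F E : A `<=` F -> F `<=` E -> subfield F -> subfield E ->
  clos E `<=` E -> value_group v E = value_group v F ->
  bounded_denominators (value_group v F) (zmultiples e) ->
  E `<=` clos (hull F).
Proof.
move=> AF FE hF hE cE vEF /bounded_denominators_zmultiples [N N0 hN].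
have AE := subset_trans AF FE.
have hullE := etale_hullP v A E; have hullF := etale_hullP v A F.
have vE := value_group_etale_hull v_complete AE hE cE.
apply: (@subset_trans _ (hull E)); first exact: sub_etale_hull.
apply: (@approx_closure _ _ _ (e / N%:R)).
- by rewrite divr_gt0 // ltr0n.
- exact: etale_hull_subset.
- exact: subfield0.
- exact: subfield0.
- by move=> x y Ex Fy; apply: (subfieldB hullE) => //; exact: (etale_hull_subset FE).
- by move=> x y; exact: (subfieldD hullF).
- by rewrite vE vEF.
move=> y Ey y0; have [t vy] := val_finE v y0.
have [c Fc vc] : value_group v F t by rewrite -vEF -vE; exists y.
have [a ea ha] := etale_approx y0 (etrans vc (esym vy)).
exists (a * c) => //; apply: (subfieldM hullF); first exact: etale_sub_hull.
exact: sub_etale_hull.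
Qed.

(** The closure [N] of the hull of the closure of [A(x)] is finite over the
    closure [M] of the hull of [A]: the residue fields agree and the value groups have finite
    index. *)
Lemma bounded_ramification_algebraic x :
  bounded_denominators (value_group v (adjoin A x)) (zmultiples e) ->
  algebraic_over (clos (hull A)) x.
Proof.
move=> /bounded_denominators_zmultiples [n n0 hn]; set eps := e / n%:R in hn.
have n0' : n%:R != 0 :> R by rewrite pnatr_eq0 -lt0n.
have epsn : eps *+ n = e by rewrite /eps -mulr_natr mulfVK.
have hAx : subfield (adjoin A x) by exact: generated_subfieldP.
have AAx : A `<=` adjoin A x by move=> a ha; apply: sub_generated_subfield; left.
pose L1 := clos (adjoin A x); have hL1 : subfield L1 by exact: closure_subfield.
have AL1 : A `<=` L1 by apply: subset_trans AAx _; exact: sub_closure.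
have cL1 : clos L1 `<=` L1 by exact: closure_idem.
have L1x : L1 x by apply: sub_closure; apply: sub_generated_subfield; right.
pose M := clos (hull A); have hM : subfield M by exact: closed_hull_subfield.
have cM : clos M `<=` M by exact: closure_idem.
have AM : A `<=` M by apply: subset_trans (@sub_etale_hull _ _ _ _ _) _; exact: sub_closure.
pose N := clos (hull L1); have hN : subfield N by exact: closed_hull_subfield.
have MN : M `<=` N by apply: closure_subset; exact: etale_hull_subset.
have L1N : L1 `<=` N by apply: subset_trans (@sub_etale_hull _ _ _ _ _) _; exact: sub_closure.
have vN : value_group v N `<=` zmultiples eps.
  rewrite value_group_closure value_group_etale_hull // value_group_closure.
  exact: hn.
(* one element of [N] for each class of values modulo those of [A] *)
have /choice [b hb] : forall i : 'I_n, exists b, N b /\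
    ((exists2 m : int, True & exists2 y, N y & v y = (eps *+ i + e *~ m)%:E) ->
     exists2 m : int, True & v b = (eps *+ i + e *~ m)%:E).
  move=> i; have [[m _ [y Ny vy]]|no] := pselect (exists2 m : int, True &
      exists2 y, N y & v y = (eps *+ i + e *~ m)%:E).
    by exists y; split=> // _; exists m.
  by exists 0; split=> //; exact: subfield0.
have NW : N `<=` linear_span M b.
  apply: (@subset_trans _ (clos (linear_span M b))); last exact: linear_span_closed.
  have sW : linear_span M b `<=` N by apply: linear_span_sub => // i; exact: (hb i).1.
  apply: (@approx_closure _ _ _ eps) => //.
  - by rewrite divr_gt0 // ltr0n.
  - exact: subfield0.
  - by exists (fun=> 0) => [i|]; [exact: subfield0|rewrite big1 // => i _; rewrite mul0r].
  - by move=> y z Ny /sW Nz; exact: (subfieldB hN).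
  - move=> y z Wy Wz; rewrite -[z]opprK; apply: linear_spanB => //.
    by rewrite -mulN1r; apply: linear_span_scale => //; apply: (subfieldN hM); exact: (subfield1 hM).
  move=> y Ny y0; have [t vy] := val_finE v y0.
  have [k _ kt] : zmultiples eps t by apply: vN; exists y.
  have nz : (n%:Z != 0)%R by rewrite eqz_nat -lt0n.
  pose i := `|(k %% n)%Z|%N.
  have lt_in : (i < n)%N.
    by rewrite -ltz_nat gez0_abs ?modz_ge0 //; have := ltz_mod k nz; rewrite ger0_norm.
  have tE : t = eps *+ i + e *~ (k %/ n)%Z.
    rewrite -kt {1}(divz_eq k n) mulrzDr addrC; congr (_ + _).
      by rewrite -{1}(gez0_abs (modz_ge0 k nz)).
    by rewrite mulrC mulrzA -pmulrn epsn.
  have [m _ vb] : exists2 m : int, True & v (b (Ordinal lt_in)) = (eps *+ i + e *~ m)%:E.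
    apply: (hb (Ordinal lt_in)).2; exists (k %/ n)%Z => //; exists y => //.
    by rewrite vy tE.
  have [c Ac vc] : value_group v A (e *~ ((k %/ n)%Z - m)) by rewrite valA; exists ((k %/ n)%Z - m).
  have vcb : v (c * b (Ordinal lt_in)) = v y.
    by rewrite (val_eqM vc vb) vy tE mulrzBr; congr (_%:E); ring.
  have [a ea ha] := etale_approx y0 vcb.
  exists (a * (c * b (Ordinal lt_in))) => //.
  rewrite mulrA; apply: linear_span_scale => //; last exact: linear_span_gen.
  apply: (subfieldM hM); last exact: AM.
  by apply: sub_closure; exact: etale_sub_hull.
apply: (@linear_span_algebraic _ _ n b) => // i; apply: NW; apply: (subfieldX hN).
exact: L1N.
Qed.

(** [W] stands for the algebraic closure of [A]. *)
Variable W : set C.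
Hypothesis W_algebraic : forall x, W x -> algebraic_over A x.
Hypothesis W_dense : forall x, clos W x.
Hypothesis W_root : forall n x, (0 < n)%N -> algebraic_over A x -> exists y, y ^+ n = x.

Definition in_finite_hull x :=
  exists2 F, finite_extension A F & clos (hull F) x.

(** Newton iteration from an algebraic [b] near [x], inside the closure of the
    hull of [A(b)]. *)
Lemma simple_root_in_finite_hull (p : {poly C}) x : (forall i, clos (hull A) p`_i) ->
  root p x -> p^`().[x] != 0 -> in_finite_hull x.
Proof.
move=> hp px p'x; have [d hd] := simple_root_mem v px p'x.
have [b Wb xb] := W_dense x d.
have [F [finF AF Fb]] := finite_extension_adjoin (finite_extension_refl subA) (W_algebraic Wb).
exists F => //; apply: (hd _ b); rewrite 1?val_geBC //.
- exact: closed_hull_subfield.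
- exact: closure_idem.
- by move=> i; apply: closure_subset (hp i); exact: etale_hull_subset.
by apply: sub_closure; apply: sub_etale_hull.
Qed.

(** Let [d] generate the values of [F] and let [w] be a [p]-th root of an element
    of value [d]. The [p]-th roots of elements of the closed hull of [F] have
    values in the multiples of [d / p], that is, values of powers of [w]; as
    étale elements represent all residues, digit expansions with powers of [w]
    reach these roots. *)
Lemma pchar_root_in_finite_hull (p : nat) x : p \in [pchar C] ->
  in_finite_hull (x ^+ p) -> in_finite_hull x.
Proof.
move=> charp [F finF hx]; have p_gt0 : (0 < p)%N by exact/prime_gt0/(pcharf_prime charp).
have [hF AF cF bdF vF] := finite_extension_facts finF.
have [N N0 hN] := bounded_denominators_zmultiples bdF.
have Fe : value_group v F e by apply: (value_group_subset AF); rewrite valA; exists 1.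
have [|d d0 vFd] := zmultiples_cyclic _ e_gt0 Fe hN (fun g h => value_groupB hF).
  by rewrite divr_gt0 // ltr0n.
have [t Ft vt] : value_group v F d by rewrite vFd; exists 1.
have algt := finite_extension_algebraic subA finF Ft.
have [w wt] := W_root p_gt0 algt.
have Fw : algebraic_over F w.
  exists ('X^p - t%:P); split.
  - by apply: monic_neq0; rewrite monicXnsubC.
  - move=> i; rewrite coefB coefXn coefC; apply: subfieldB => //.
      by case: eqP => _; [exact: subfield1|exact: subfield0].
    by case: eqP => _ //; exact: subfield0.
  by rewrite /root hornerD hornerN hornerXn hornerC wt subrr.
have [F1 [finF1 FF1 F1w]] := finite_extension_adjoin (finite_extension_refl hF) Fw.
have finAF1 := finite_extension_tower finF finF1.
exists F1 => //.
have [hF1 AF1 cF1 _ _] := finite_extension_facts finAF1.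
pose dp := d / p%:R; have p0' : p%:R != 0 :> R by rewrite pnatr_eq0 -lt0n.
have dpp : dp *+ p = d by rewrite /dp -mulr_natr mulfVK.
have vw : v w = dp%:E.
  by move: vt; rewrite -wt -dpp; case: (p) p_gt0 => // k _; exact: val_eqX_div.
pose M := clos (hull F); have hM : subfield M by exact: closed_hull_subfield.
(* the field of [p]-th roots of elements of [M] *)
pose N1 := pFrobenius_aut charp @^-1` M.
have N1E y : N1 y = M (y ^+ p) by rewrite /N1 /preimage /= pFrobenius_autE.
have hN1 : subfield N1 by exact: preimage_subfield.
pose W1 := N1 `&` hull F1; have hW1 : subfield W1.
  by apply: subfield_setI => //; exact: etale_hullP.
have W1w : W1 w.
  split; last exact: sub_etale_hull.
  by rewrite N1E wt; apply: sub_closure; exact: sub_etale_hull.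
suff : N1 `<=` clos W1.
  move=> sub; have /sub : N1 x by rewrite N1E.
  by apply: closure_subset => y [].
apply: (@approx_closure _ _ _ dp).
- by rewrite divr_gt0 // ltr0n.
- by move=> y [].
- exact: subfield0.
- exact: subfield0.
- by move=> y z N1y [N1z _]; exact: (subfieldB hN1).
- by move=> y z; exact: (subfieldD hW1).
- move=> g [y]; rewrite N1E => My vy.
  have [m _ dm] : zmultiples d (g *+ p).
    by rewrite -vFd -vF; exists (y ^+ p) => //; exact: val_eqX.
  exists m => //; apply: (mulIf p0'); rewrite [RHS]mulr_natr -dm -mulrzr -[RHS]mulrzr.
  by rewrite /dp; field.
move=> y N1y y0; have [s vy] := val_finE v y0.
have [m _ dm] : zmultiples d (s *+ p).
  rewrite -vFd -vF; exists (y ^+ p); last exact: val_eqX.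
  by move: N1y; rewrite N1E.
have sE : s = dp *~ m.
  apply: (mulIf p0'); rewrite mulr_natr -dm -mulrzr -[in RHS]mulrzr.
  by rewrite /dp; field.
have [c W1c vc] : value_group v W1 s.
  by rewrite sE; apply: value_groupMz => //; exists w.
have [a ea ha] := etale_approx y0 (etrans vc (esym vy)).
exists (a * c) => //; apply: (subfieldM hW1) => //; split; last exact: etale_sub_hull.
rewrite N1E; apply: (subfieldX hM).
by apply: sub_closure; exact: etale_sub_hull.
Qed.

(** Either [x] is a simple root of [g], or [g^`()] is a smaller annihilating
    polynomial, or [g] is a polynomial in ['X^p]. *)
Lemma algebraic_in_finite_hull x : algebraic_over (clos (hull A)) x -> in_finite_hull x.
Proof.
pose M := clos (hull A); have hM : subfield M by exact: closed_hull_subfield.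
move=> [g [g0 Mg gx]]; elim: (size g) {-2}g (leqnn (size g)) x g0 Mg gx => [|n IH] {}g.
  by rewrite leqn0 size_poly_eq0 => /eqP -> x; rewrite eqxx.
move=> sg x g0 Mg gx.
have [g'x|] := eqVneq (g^`().[x]) 0; last exact: simple_root_in_finite_hull.
have [g'0|g'0] := eqVneq g^`() 0; last first.
  apply: (IH g^`()) => //; last by apply/eqP.
    by rewrite -ltnS (leq_trans _ sg) // lt_size_deriv.
  move=> i; rewrite coef_deriv; have := Mg i.+1; move: g`_i.+1 => c Mc.
  elim: (i.+1) => [|k IHk]; first by rewrite mulr0n; exact: (subfield0 hM).
  by rewrite mulrS; exact: (subfieldD hM).
have gi0 i : g`_i *+ i = 0.
  case: i => [|i]; first by rewrite mulr0n.
  by rewrite -coef_deriv g'0 coef0.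
have sg1 : (1 < size g)%N.
  rewrite ltnNge; apply/negP => /size1_polyC gc; move: gx g0; rewrite gc /root hornerC polyC_eq0.
  by move=> ->.
have [p charp] : exists p, p \in [pchar C].
  have /eqP := gi0 (size g).-1; rewrite -mulr_natr mulf_eq0 -lead_coefE lead_coef_eq0 (negbTE g0) /=.
  by apply: natf0_pchar; rewrite -ltnS prednK // ltnW.
have p_prime := pcharf_prime charp; have p_gt1 := prime_gt1 p_prime.
pose h := \poly_(i < (size g).-1) g`_(i * p).
have gh : g = h \Po 'X^p.
  apply/polyP => i; rewrite coef_comp_poly_Xn ?prime_gt0 //.
  case: ifP => [pi|/negbT pi]; last first.
    apply/eqP; apply: contraNT pi => gi; have /eqP := gi0 i.
    by rewrite -mulr_natr mulf_eq0 (negbTE gi) (dvdn_pcharf charp).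
  rewrite coef_poly divnK //; case: ltnP => // si.
  apply: nth_default; rewrite -(divnK pi).
  rewrite (leq_trans _ (leq_mul si p_gt1)) //.
  by move: sg1; clear; case: (size g) => // [[|k]] // _ /=; lia.
apply: (pchar_root_in_finite_hull charp); apply: (IH h).
- rewrite (leq_trans (size_poly _ _)) //; move: sg; case: (size g) => //.
- by apply: contraNneq g0 => h0; rewrite gh h0 comp_poly0.
- by move=> i; rewrite coef_poly; case: ifP => _ //; exact: (subfield0 hM).
by move: gx; rewrite /root {1}gh horner_comp hornerXn.
Qed.

Theorem bounded_ramificationE x :
  bounded_ramification v A x <-> in_finite_hull x.
Proof.
have hAx : subfield (adjoin A x) by exact: generated_subfieldP.
split=> [fin|[F finF hx]].
  apply: algebraic_in_finite_hull; apply: bounded_ramification_algebraic.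
  rewrite -valA; apply: finite_index_bounded_denominators fin.
  - by move=> g n hg; rewrite pmulrn; exact: value_groupMz.
  - exact: value_group0.
  - by move=> g h; exact: value_groupB.
rewrite /bounded_ramification /ramification_index /= valA.
apply: zmultiples_finite_index.
have [hF AF cF bdF vF] := finite_extension_facts finF.
apply: bounded_denominators_sub bdF; rewrite -vF; apply: value_group_subset.
apply: generated_subfield_sub; first exact: closed_hull_subfield.
move=> y [Ay|->] //; apply: sub_closure; apply: sub_etale_hull; exact: AF.
Qed.

End BoundedRamification.

(** * Lifting residues *)

Section ResidueMorphism.
Context {R : realType} {L : fieldType} (v : valuation R L).

Fact residue_is_zmod_morphism : zmod_morphism (residue (v := v)).
Proof.
by move=> x y; exact: (rmorphB (\pi_{ideal_quot @maximal_ideal _ _ v})%qT x y).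
Qed.

Fact residue_is_monoid_morphism : monoid_morphism (residue (v := v)).
Proof. by split; [exact: residue1|exact: residueM]. Qed.

HB.instance Definition _ := GRing.isZmodMorphism.Build (valuation_ring v)
  (residue_field v) (residue (v := v)) residue_is_zmod_morphism.
HB.instance Definition _ := GRing.isMonoidMorphism.Build (valuation_ring v)
  (residue_field v) (residue (v := v)) residue_is_monoid_morphism.

Lemma val_ge_valuation_ring (x : valuation_ring v) : val_ge v 0 (val x).
Proof. exact: (valP x). Qed.

End ResidueMorphism.

Section Extension.
Context {R : realType} {K L : fieldType} (v : valuation R K) (w : valuation R L).
Variable f : {rmorphism K -> L}.
Hypothesis w_f : forall x, w (f x) = v x.

Fact ring_ext_subproof (x : valuation_ring v) : in_valuation_ring w (f (val x)).
Proof. by rewrite /in_valuation_ring w_f; exact: (valP x). Qed.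

Definition ring_ext (x : valuation_ring v) : valuation_ring w :=
  Sub (f (val x)) (ring_ext_subproof x).

Lemma val_ring_ext x : val (ring_ext x) = f (val x).
Proof. by []. Qed.

Fact ring_ext_is_zmod_morphism : zmod_morphism ring_ext.
Proof. by move=> x y; apply: val_inj; rewrite /= !rmorphB. Qed.

Fact ring_ext_is_monoid_morphism : monoid_morphism ring_ext.
Proof.
by split=> [|x y]; apply: val_inj; rewrite /= ?rmorph1 // !rmorphM.
Qed.

HB.instance Definition _ := GRing.isZmodMorphism.Build (valuation_ring v)
  (valuation_ring w) ring_ext ring_ext_is_zmod_morphism.
HB.instance Definition _ := GRing.isMonoidMorphism.Build (valuation_ring v)
  (valuation_ring w) ring_ext ring_ext_is_monoid_morphism.

(** The map induced on residue fields, computed on representatives. *)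
Definition residue_ext (q : residue_field v) : residue_field w :=
  residue (ring_ext (repr q : valuation_ring v)).

Lemma residue_extE x : residue_ext (residue x) = residue (ring_ext x).
Proof.
apply/eqP; rewrite /residue_ext -subr_eq0 -!rmorphB residue_eq0 val_ring_ext w_f.
by rewrite -residue_eq0 rmorphB /= residueK subrr.
Qed.

Fact residue_ext_is_zmod_morphism : zmod_morphism residue_ext.
Proof.
move=> x y; rewrite -(residueK x) -(residueK y) -rmorphB !residue_extE.
by rewrite !rmorphB.
Qed.

Fact residue_ext_is_monoid_morphism : monoid_morphism residue_ext.
Proof.
split=> [|x y]; first by rewrite -(rmorph1 (residue (v := v))) residue_extE !rmorph1.
by rewrite -(residueK x) -(residueK y) -rmorphM !residue_extE !rmorphM.
Qed.

HB.instance Definition _ := GRing.isZmodMorphism.Build (residue_field v)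
  (residue_field w) residue_ext residue_ext_is_zmod_morphism.
HB.instance Definition _ := GRing.isMonoidMorphism.Build (residue_field v)
  (residue_field w) residue_ext residue_ext_is_monoid_morphism.

End Extension.

Section PerfectField.
Variables (F L : fieldType) (f : {rmorphism F -> L}).

(** A nonzero polynomial of least degree vanishing at [x] is irreducible. *)
Lemma perfect_separable_root (p : {poly F}) x : perfect_field F -> p != 0 ->
  root (map_poly f p) x ->
  exists q : {poly F}, [/\ q \is monic, separable_poly q & root (map_poly f q) x].
Proof.
move=> perfF p0 px.
have exn : exists n, `[< exists q, [/\ q != 0, root (map_poly f q) x & size q = n] >].
  by exists (size p); apply/asboolP; exists p.
have [m /asboolP [q [q0 qx sq]] qmin] := ex_minnP exn.
have minq d : d != 0 -> root (map_poly f d) x -> (size q <= size d)%N.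
  by move=> d0 dx; rewrite sq; apply: qmin; apply/asboolP; exists d.
have sq1 : (1 < size q)%N.
  rewrite ltnNge; apply/negP => /size1_polyC qc; move: qx q0.
  by rewrite qc map_polyC /root hornerC fmorph_eq0 polyC_eq0 => /eqP ->; rewrite eqxx.
have irrq : irreducible_poly q.
  split=> // d sd /dvdpP [c qcd].
  have c0 : c != 0 by apply: contraNneq q0 => c0; rewrite qcd c0 mul0r.
  have d0 : d != 0 by apply: contraNneq q0 => d0; rewrite qcd d0 mulr0.
  have dq : d %| q by rewrite qcd dvdp_mull.
  move: qx; rewrite qcd rmorphM /= rootM -qcd => /orP[/(minq _ c0)|/(minq _ d0)] sle.
    have sd0 : (0 < size d)%N by rewrite size_poly_gt0.
    case/negP: sd; rewrite eqn_leq sd0 andbT; move: sle; rewrite {1}qcd size_mul //.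
    by move: (size c) (size d) sd0 => m1 m2; clear; lia.
  by rewrite -dvdp_size_eqp // eqn_leq sle dvdp_leq.
exists ((lead_coef q)^-1 *: q); have lq : (lead_coef q)^-1 != 0 by rewrite invr_eq0 lead_coef_eq0.
split; first by rewrite monicE lead_coefZ mulVf // lead_coef_eq0.
  by rewrite (eqp_separable (eqp_scale _ _)) //; exact: perfF.
by rewrite map_polyZ rootZ // fmorph_eq0.
Qed.

End PerfectField.

Section EtaleLift.
Context {R : realType} {K Khat : fieldType} {Kbar : closedFieldType}.
Variables (v : valuation R K) (vhat : valuation R Khat) (vbar : valuation R Kbar).
Variables (i : {rmorphism K -> Khat}) (j : {rmorphism Khat -> Kbar})
  (f : {rmorphism K -> Kbar}).
Hypotheses (vhat_i : forall x, vhat (i x) = v x)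
  (i_dense : valuation_closure vhat (range i) = [set: Khat])
  (vbar_j : forall x, vbar (j x) = vhat x)
  (Kbar_algebraic : forall x, algebraicOver j x)
  (fE : forall x, f x = j (i x))
  (residue_perfect : perfect_field (residue_field v)).

Let vbar_f x : vbar (f x) = v x. Proof. by rewrite fE vbar_j vhat_i. Qed.

Local Notation ext := (ring_ext vbar_f).
Local Notation rext := (residue_ext vbar_f).
Local Notation rmap := (map_poly (residue (v := v))).

Lemma residue_ext_horner (P : {poly valuation_ring v}) (Y : valuation_ring vbar) :
  (map_poly rext (rmap P)).[residue Y] = residue (map_poly ext P).[Y].
Proof.
rewrite -horner_map -!map_poly_comp; congr (_.[_]).
by apply: eq_map_poly => x /=; rewrite residue_extE.
Qed.

(** Divide an annihilating polynomial of [Y] by a coefficient of minimal value,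
    then approximate its coefficients by elements of [K]. *)
Lemma residue_algebraic (Y : valuation_ring vbar) :
  exists2 p : {poly residue_field v}, p != 0 & root (map_poly rext p) (residue Y).
Proof.
have [p0 p0_neq0 /eqP p0Y] := Kbar_algebraic (val Y).
have s0 : (0 < size p0)%N by rewrite size_poly_gt0.
pose i0 := Ordinal (etrans (ltn_predL _) s0).
have pi0 : p0`_i0 != 0 by rewrite /= -lead_coefE lead_coef_eq0.
case: (@arg_minP _ _ _ i0 (fun k : 'I_(size p0) => p0`_k != 0) (fun k => vhat p0`_k) pi0).
move=> m pm hmin; set c := p0`_m in pm hmin; have [t vc] := val_finE vhat pm.
have ip k : val_ge vhat 0 (p0`_k / c).
  have [->|pk] := eqVneq p0`_k 0; first by rewrite mul0r val_ge0.
  have sk : (k < size p0)%N by rewrite ltnNge; apply: contra pk => /(nth_default 0) ->.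
  rewrite -[0](addrN t); apply: val_geM; last exact/val_eq_ge/val_eqV.
  by rewrite /val_ge -vc; exact: (hmin (Ordinal sk)).
have /choice [a ha] : forall k, exists a : valuation_ring v,
    val_ge vhat 1 (p0`_k / c - i (val a)).
  move=> k; have : valuation_closure vhat (range i) (p0`_k / c) by rewrite i_dense.
  move=> /(_ 1) [_ [x _ <-] hx].
  have ix : in_valuation_ring v x.
    rewrite /in_valuation_ring -vhat_i -[i x](subKr (p0`_k / c)).
    by apply: val_geB => //; apply: val_ge_le hx.
  by exists (Sub x ix).
exists (rmap (\poly_(k < size p0) a k)).
  apply/negP => /eqP/polyP/(_ m); rewrite coef_map coef_poly ltn_ord coef0 => /eqP.
  rewrite /= residue_eq0 -vhat_i => hm.
  have : (0%E < vhat (p0`_m / c)%R)%E.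
    rewrite -(subrK (i (val (a m))) (p0`_m / c)); apply: val_gt0D => //.
    by apply: val_ge_gt (ha m); exact: ltr01.
  by rewrite divff // val1 ltxx.
rewrite /root residue_ext_horner residue_eq0 -horner_map.
have -> : (map_poly val (map_poly ext (\poly_(k < size p0) a k))).[val Y] =
    - \sum_(k < size p0) j (p0`_k / c - i (val (a k))) * val Y ^+ k.
  rewrite -map_poly_comp (horner_coef_wide _ (n := size p0)); last first.
    by rewrite (leq_trans (size_poly _ _)) // size_poly.
  under [X in _ = - X]eq_bigr do rewrite rmorphB mulrBl.
  rewrite sumrB opprB -[LHS]subr0; congr (_ - _).
    by apply: eq_bigr => k _; rewrite coef_map coef_poly ltn_ord /= fE.
  apply/esym; under eq_bigr do rewrite rmorphM mulrAC.
  rewrite -mulr_suml (_ : \sum_(k < _) _ = 0) ?mul0r // -[RHS]p0Y.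
  rewrite (horner_coef_wide _ (n := size p0)) ?size_map_poly //.
  by apply: eq_bigr => k _; rewrite coef_map.
rewrite valN; apply: (val_ge_gt ltr01); apply: val_ge_sum => k _.
rewrite mulrC; apply: val_ge0M; first exact/val_ge0X/val_ge_valuation_ring.
by rewrite /val_ge vbar_j; exact: ha.
Qed.

Lemma residue_separable_root (Y : valuation_ring vbar) :
  exists q : {poly residue_field v},
    [/\ q \is monic, separable_poly q & root (map_poly rext q) (residue Y)].
Proof.
by have [p p0 pY] := residue_algebraic Y; exact: perfect_separable_root pY.
Qed.

Lemma monic_lift (q : {poly residue_field v}) : q \is monic ->
  exists2 Q : {poly valuation_ring v}, Q \is monic & rmap Q = q.
Proof.
move=> mq; have s0 : (0 < size q)%N by rewrite size_poly_gt0 monic_neq0.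
pose E k : valuation_ring v := if k == (size q).-1 then 1 else repr q`_k.
exists (\poly_(k < size q) E k).
  rewrite monicE lead_coefE size_poly_eq; first by rewrite coef_poly ltn_predL s0 /E eqxx.
  by rewrite /E eqxx oner_neq0.
apply/polyP => k; rewrite coef_map coef_poly; case: ltnP => [sk|/leq_sizeP->//]; last first.
  by rewrite raddf0.
rewrite /E; case: eqP => [->|_] /=; last exact: residueK.
by rewrite residue1 -lead_coefE (monicP mq).
Qed.

(** Lift a separable polynomial with root the residue of [Y]. Its lift splits, and
    the product of the distances of its roots to [Y] lies in the maximal ideal,
    so one of the roots is congruent to [Y]. *)
Lemma etale_lift (Y : valuation_ring vbar) :
  exists2 b, etale vbar (range j) b & (0%E < vbar (val Y - b)%R)%E.
Proof.
have [q [mq sq qY]] := residue_separable_root Y.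
have [Q mQ Qq] := monic_lift mq.
pose p := map_poly val (map_poly ext Q).
have mp : p \is monic by rewrite !monic_map.
have pk k : p`_k = j (i (val Q`_k)).
  by rewrite /p -map_poly_comp coef_map /= fE.
have ip : integral_coefs vbar p.
  by move=> k; rewrite pk /val_ge vbar_j vhat_i; exact: val_ge_valuation_ring.
have vpY : (0%E < vbar p.[val Y])%E.
  by rewrite horner_map -residue_eq0 -residue_ext_horner Qq; exact: qY.
have vp'Y : vbar p^`().[val Y] = 0%:E.
  rewrite !deriv_map horner_map; apply: val_unit; first exact: val_ge_valuation_ring.
  rewrite -residue_eq0 -residue_ext_horner -deriv_map Qq.
  by apply: coprimep_root qY; rewrite coprimep_map; move: sq; rewrite separable_poly.unlock.
have [s pE] := closed_field_poly_normal p.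
rewrite (monicP mp) scale1r in pE.
have [b bs hb] : exists2 b, b \in s & (0%E < vbar (val Y - b)%R)%E.
  apply: contrapT => no; move: vpY; rewrite pE horner_prod ltNge => /negP; apply.
  rewrite big_seq; elim/big_ind: _ => [|x y hx hy|b bs]; first by rewrite val1.
    by rewrite Defs.valM -[X in (_ <= X)%E]adde0; apply: leeD.
  rewrite hornerXsubC leNgt; apply/negP => hb; apply: no.
  by exists b.
have [e e0 heb] := val_gt_ge hb; have iY := val_ge_valuation_ring Y.
have ib : val_ge vbar 0 b.
  rewrite -(subKr (val Y) b); apply: val_geB => //; apply: val_ge_le heb; exact: ltW.
exists b => //; split=> //; exists p; split=> //.
- by move=> k; rewrite pk; exists (i (val Q`_k)).
- by rewrite pE root_prod_XsubC.
have [_ h2 _] := integral_taylor (integral_coefs_deriv ip) iY ib heb.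
exact: val_eq_near_ge vp'Y e0 h2.
Qed.

End EtaleLift.

(** * Transfer to the algebraic closure *)

Section Index.
Context {R : realType}.
Implicit Types G H : set R.

Lemma subgroup_index_eq1 G H : G 0 -> H 0 ->
  subgroup_index G H = Some 1%N -> G `<=` H.
Proof.
move=> G0 H0; rewrite /subgroup_index; set C := (X in finite_set X).
case: asboolP => // finC [/eqP/cardfs1P [c Cc]] g Gg.
have inC x : C x -> x = c.
  by move=> Cx; apply/fset1P; rewrite -Cc in_fset_set // inE.
have := inC [set g + h | h in H] (ex_intro2 _ _ g Gg erefl).
rewrite -(inC [set 0 + h | h in H]); last by exists 0.
move=> gH; have : [set g + h | h in H] g by exists 0; rewrite ?addr0.
by rewrite gH => -[h Hh <-]; rewrite add0r.
Qed.

Lemma subgroup_index_refl H : H 0 -> (forall g h, H g -> H h -> H (g - h)) ->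
  subgroup_index H H = Some 1%N.
Proof.
move=> H0 Hsub; rewrite /subgroup_index.
have -> : [set [set g + h | h in H] | g in H] = [set H].
  have cosetE g : H g -> [set g + h | h in H] = H.
    move=> Hg; apply/seteqP; split=> [_ [h Hh <-]|h Hh].
      rewrite -[h]opprK; apply: (Hsub _ _) => //; rewrite -sub0r; exact: Hsub.
    by exists (h - g); [exact: Hsub|rewrite addrCA subrr addr0].
  apply/seteqP; split=> [_ [g Hg <-]|_ ->]; first exact: cosetE.
  by exists 0 => //; exact: cosetE.
by rewrite asboolT ?fset_set1 ?cardfs1 //; exact: finite_set1.
Qed.

End Index.

Section Embedding.
Context {R : realType} {F L : fieldType} (u : valuation R F) (w : valuation R L).
Variable f : {rmorphism F -> L}.
Hypothesis w_f : forall x, w (f x) = u x.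
Implicit Types (A E : set F).

Lemma value_group_image A : value_group w (f @` A) = value_group u A.
Proof.
apply/seteqP; split=> g; first by move=> [_ [x Ax <-]]; rewrite w_f; exists x.
by move=> [x Ax ux]; exists (f x); rewrite ?w_f //; exists x.
Qed.

(** An isometry transports Cauchy sequences back. *)
Lemma complete_range_closed : valuation_complete u ->
  valuation_closure w (range f) `<=` range f.
Proof.
move=> cu x hx; have /choice [a ha] : forall n : nat, exists y, val_ge w n%:R (x - f y).
  by move=> n; have [_ [y _ <-] hy] := hx n%:R; exists y.
have [n m nm|y hy] := @cauchy_limit _ _ u cu a 0 1 ltr01.
  rewrite add0r /val_ge -w_f rmorphB; apply: (@val_ge_trans _ _ _ _ x).
    by rewrite val_geBC; exact: ha.
  by apply: val_ge_le (ha m); rewrite ler_nat.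
exists y => //; apply/esym/eqP; rewrite -subr_eq0; apply/eqP/(val_ge_eq0 (v := w)) => r.
have [n] := ler_linear 0 r ltr01; rewrite add0r => hn; apply: (val_ge_le hn).
apply: val_ge_trans (ha n) _.
by have := hy n; rewrite add0r /val_ge -w_f rmorphB.
Qed.

Lemma finite_extension_image A E : finite_extension A E ->
  finite_extension (f @` A) (f @` E).
Proof.
move=> [hE AE [n [b Eb]]]; split; first exact: image_subfield.
  exact: image_subset.
exists n, (f \o b); rewrite Eb; apply/seteqP; split.
  move=> _ [_ [c hc <-] <-]; exists (f \o c) => [k|].
    by exists (c k).
  by rewrite raddf_sum; apply: eq_bigr => k _; rewrite /= rmorphM.
move=> _ [c hc <-]; have /choice [d hd] : forall k, exists y, A y /\ f y = c k.
  by move=> k; have [y Ay <-] := hc k; exists y.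
exists (\sum_k d k * b k); first by exists d => // k; exact: (hd k).1.
by rewrite raddf_sum; apply: eq_bigr => k _; rewrite /= rmorphM (hd k).2.
Qed.

Lemma finite_extension_preimage (A E : set L) : subfield A -> A `<=` range f -> E `<=` range f ->
  finite_extension A E -> finite_extension (f @^-1` A) (f @^-1` E).
Proof.
move=> hA Af Ef [hE AE [n [b Eb]]]; split; first exact: preimage_subfield.
  by move=> x; exact: AE.
have /choice [d hd] : forall k, exists y, f y = b k.
  move=> k; have /Ef [y _ <-] : E (b k) by rewrite Eb; exact: linear_span_gen.
  by exists y.
exists n, d; apply/seteqP; split=> x /=.
  rewrite Eb => -[c hc fx].
  have /choice [a ha] : forall k, exists y, f y = c k.
    by move=> k; have [y _ <-] := Af _ (hc k); exists y.
  exists a => [k|]; first by rewrite /= ha; exact: hc.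
  apply: (fmorph_inj f); rewrite raddf_sum -fx; apply: eq_bigr => k _.
  by rewrite /= rmorphM hd ha.
move=> [c hc <-]; rewrite Eb raddf_sum; exists (f \o c) => [k|]; first exact: hc.
by apply: eq_bigr => k _; rewrite /= rmorphM hd.
Qed.

End Embedding.

Section AlgebraicallyClosed.
Variables (F : closedFieldType) (L : fieldType) (f : {rmorphism F -> L}).

(** A polynomial over an algebraically closed subfield splits there. *)
Lemma algebraic_in_range (A : set L) x : A `<=` range f -> algebraic_over A x -> range f x.
Proof.
move=> Af [p [p0 Ap px]]; have [|q qp] := @map_poly_range _ _ f p.
  by move=> i; exact: Af.
have [s qE] := closed_field_poly_normal q.
have q0 : lead_coef q != 0.
  by rewrite lead_coef_eq0 -(map_poly_eq0 f) qp.
move: px; rewrite -qp qE map_polyZ rootZ ?fmorph_eq0 // rmorph_prod /root horner_prod.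
rewrite prodf_seq_eq0 => /hasP [y _ /=].
by rewrite rmorphB /= map_polyX map_polyC hornerXsubC subr_eq0 => /eqP ->; exists y.
Qed.

Lemma closed_field_nth_root n (x : F) : (0 < n)%N -> exists y, y ^+ n = x.
Proof.
move=> n0; have /closed_rootP [y] : size ('X^n - x%:P) != 1.
  by rewrite size_XnsubC // eqSS -lt0n.
by rewrite /root hornerD hornerN hornerXn hornerC subr_eq0 => /eqP; exists y.
Qed.

End AlgebraicallyClosed.

Theorem theorem5p9 (R : realType) (K Khat : fieldType) (Kbar : closedFieldType)
    (KK : fieldType)
    (v : valuation R K) (vhat : valuation R Khat) (vbar : valuation R Kbar)
    (vKK : valuation R KK)
    (i : {rmorphism K -> Khat}) (j : {rmorphism Khat -> Kbar})
    (l : {rmorphism Kbar -> KK})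
    (v_discrete : discrete_valuation v)
    (residue_perfect : perfect_field (residue_field v))
    (Khat_completion : is_completion v vhat i)
    (Kbar_algebraic : forall x : Kbar, algebraicOver j x)
    (vbar_extends : forall x : Khat, vbar (j x) = vhat x)
    (KK_completion : is_completion vbar vKK l) :
  bounded_ramification vKK (range (l \o j)) =
  \bigcup_(F in [set F | finite_extension (range j) F])
    valuation_closure vKK (l @` maximal_unramified vbar F).
Proof.
have [vi i_dense Khat_complete] := Khat_completion.
have [vl l_dense KK_complete] := KK_completion.
have [g g0 vg] := v_discrete.
set A := range (l \o j); pose e := `|g|.
have e_gt0 : 0 < e by rewrite normr_gt0.
have subA : subfield A by exact: range_subfield.
have vlj x : vKK ((l \o j) x) = vhat x by rewrite /= vl.
have closA : valuation_closure vKK A `<=` A by exact: complete_range_closed Khat_complete.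
have valA : value_group vKK A = zmultiples e.
  rewrite zmultiples_norm /zmultiples -vg /A (value_group_image vlj) -i_dense.
  by rewrite value_group_closure (value_group_image vi).
have imjA : l @` range j = A by rewrite /A image_comp.
have Al : A `<=` range l by move=> _ [x _ <-]; exists (j x).
have fE x : (j \o i) x = j (i x) by [].
have subj : subfield (range j) by exact: range_subfield.
have W_algebraic x : range l x -> algebraic_over A x.
  move=> [y _ <-]; apply/algebraic_rangeP; have [p p0 py] := Kbar_algebraic y.
  by exists p => //; rewrite map_poly_comp fmorph_root.
have W_dense x : valuation_closure vKK (range l) x by rewrite l_dense.
have W_root n x : (0 < n)%N -> algebraic_over A x -> exists y, y ^+ n = x.
  move=> n0 /(algebraic_in_range Al) [y _ <-].
  by have [z <-] := closed_field_nth_root y n0; exists (l z); rewrite rmorphXn.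
have etale_image b : etale vbar (range j) b -> etale vKK A (l b).
  move=> [ib [p [mp jp ip pb vp]]]; split; first by rewrite /val_ge vl.
  exists (map_poly l p); split.
  - by rewrite map_monic.
  - by move=> k; rewrite coef_map -imjA; exists p`_k.
  - by move=> k; rewrite coef_map /val_ge vl; exact: ip.
  - by rewrite fmorph_root.
  by rewrite deriv_map horner_map vl.
have etale_residue u : vKK u = 0%E ->
    exists2 a, etale vKK A a & (0%E < vKK (u - a)%R)%E.
  move=> vu; have [_ [y _ <-] uy] := W_dense u 1.
  have vy : vbar y = 0%E by rewrite -vl; exact: val_eq_near_ge vu ltr01 uy.
  have iy : in_valuation_ring vbar y by rewrite /in_valuation_ring vy.
  have [b eb yb] := etale_lift vi i_dense vbar_extends Kbar_algebraic fE residue_perfect (Sub y iy).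
  exists (l b); first exact: etale_image.
  rewrite -(subrK (l y) u) -addrA; apply: val_gt0D; first exact: val_ge_gt ltr01 uy.
  by rewrite -rmorphB vl.
have inhullP := bounded_ramificationE KK_complete subA closA e_gt0 valA
  etale_residue W_algebraic W_dense W_root.
have range_hull F : finite_extension A F -> F `<=` range l.
  by move=> finF x Fx; apply: (algebraic_in_range Al); exact: finite_extension_algebraic finF Fx.
have preimA : l @^-1` A = range j.
  apply/seteqP; split=> x; last by move=> [y _ <-]; exists y.
  by move=> [y _ /(fmorph_inj l) <-]; exists y.
have imageK F : F `<=` range l -> l @` (l @^-1` F) = F.
  move=> Fl; apply/seteqP; split=> [_ [x Fx <-] //|x Fx].
  by have [y _ yx] := Fl _ Fx; exists y; rewrite //= yx.
have residue_sep F E : range j `<=` F ->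
    separable_extension (residue_subfield (v := vbar) F) (residue_subfield (v := vbar) E).
  move=> jF _ [Y _ <-].
  have [q [_ sq qY]] := residue_separable_root vi i_dense vbar_extends Kbar_algebraic fE residue_perfect Y.
  eexists; split; last exact: qY.
    rewrite qualifE; apply/(all_nthP 0) => k _; rewrite coef_map inE.
    by eexists; last reflexivity; apply: jF; eexists; last reflexivity.
  by rewrite separable_map.
have unram_refl F E : subfield E -> range j `<=` F -> value_group vbar E = value_group vbar F ->
    unramified vbar F E.
  move=> hE jF vEF; split; last exact: residue_sep.
  rewrite /ramification_index vEF; apply: subgroup_index_refl; rewrite -vEF.
    exact: value_group0.
  by move=> x y; exact: value_groupB.
apply/seteqP; split=> x.
  move=> /inhullP [F finF hx].
  have [hF AF cF bdF vF] := finite_extension_facts KK_complete subA closA valA finF.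
  have Fl := range_hull _ finF.
  exists (l @^-1` F).
    by rewrite /= -preimA; exact: finite_extension_preimage.
  have jF : range j `<=` l @^-1` F by rewrite -preimA => y; exact: AF.
  have hF0 : subfield (l @^-1` F) by exact: preimage_subfield.
  apply: closure_subset hx; apply: generated_subfield_sub.
    by apply: image_subfield; exact: generated_subfieldP.
  move=> y [Fy|ey].
    have [z _ zy] := Fl _ Fy; exists z => //.
    apply: sub_generated_subfield; exists (l @^-1` F); last by rewrite /= zy.
    by split; [exact: finite_extension_refl|exact: unram_refl].
  have [E' [finE' _ E'y vE']] := etale_extension KK_complete AF hF cF ey.
  have finAE' := finite_extension_tower finF finE'.
  have E'l := range_hull _ finAE'; have [z _ zy] := E'l _ E'y.
  exists z => //; apply: sub_generated_subfield; exists (l @^-1` E'); last by rewrite /= zy.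
  split; first exact: finite_extension_preimage.
  apply: unram_refl => //; first by apply: preimage_subfield; case: finE'.
  by rewrite -!(value_group_image vl) !imageK.
move=> [F finF hx]; apply/inhullP; exists (l @` F).
  by rewrite -imjA; exact: finite_extension_image.
have finAF : finite_extension A (l @` F) by rewrite -imjA; exact: finite_extension_image.
have [hF AF cF bdF vF] := finite_extension_facts KK_complete subA closA valA finAF.
apply: closure_idem; apply: closure_subset hx => _ [y hy <-].
have hclos : subfield (valuation_closure vKK (etale_hull vKK A (l @` F))).
  exact: closed_hull_subfield.
apply: (generated_subfield_sub (preimage_subfield l hclos) _ hy) => z [E [finE [ramE _]] Ez].
have finE' := finite_extension_image l finE.
have [hE FE _] := finE'; have [hE0 FE0 _] := finE.
have hF0 : subfield F by case: finF.
have cE := finite_extension_closed KK_complete cF hF finE'.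
have : (l @` E) (l z) by exists z.
apply: (unramified_sub_hull KK_complete e_gt0 etale_residue AF FE hF hE cE _ bdF).
apply/seteqP; split; last exact: value_group_subset.
rewrite !(value_group_image vl); apply: subgroup_index_eq1 ramE; exact: value_group0.
Qed.
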